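(* Let $\lambda_w\in\operatorname{End}(\mathcal{O}_2)$ (with $w\in\mathcal{U}(\mathcal{O}_2)$) satisfy one of the following conditions: (1) $\lambda_w(\mathcal{F}_2)\subseteq\mathcal{F}_2$; (2) $\lambda_w(\mathcal{D}_2)=\mathcal{D}_2$. Then $\lambda_w$ admits at most one extension to an endomorphism of $\mathcal{Q}_2$. Moreover, if $\lambda_w$ has a unique extension $\tilde\lambda_w\in\operatorname{End}(\mathcal{Q}_2)$, then $$\lambda_w(\mathcal{O}_2)'\cap\mathcal{Q}_2\subseteq C^*(\tilde\lambda_w(u))'\cap\mathcal{Q}_2 .$$
   Context: The 2-adic ring $C^*$-algebra $\mathcal{Q}_2$ is the universal unital $C^*$-algebra generated by a unitary $u$ and an isometry $s_2$ with $s_2u=u^2s_2$ and $s_2s_2^*+us_2s_2^*u^*=1$. Put $s_1:=us_2$; then $\mathcal{O}_2:=C^*(s_1,s_2)\subseteq\mathcal{Q}_2$ is the canonical copy of the Cuntz algebra. For $t\in\mathbb{T}$ the gauge automorphism $\alpha_t$ of $\mathcal{Q}_2$ is given by $\alpha_t(u)=u$, $\alpha_t(s_2)=ts_2$. $\mathcal{F}_2$ is the fixed-point algebra of the gauge action restricted to $\mathcal{O}_2$, and $\mathcal{D}_2$ is the diagonal subalgebra, generated by the projections $s_{\mu}s_{\mu}^*$ with $s_\mu=s_{\mu_1}\cdots s_{\mu_k}$, $\mu_j\in\{1,2\}$. Endomorphisms are unital $*$-endomorphisms. For $w\in\mathcal{U}(\mathcal{O}_2)$, $\lambda_w\in\operatorname{End}(\mathcal{O}_2)$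 is determined by $\lambda_w(s_i)=ws_i$ ($i=1,2$); every endomorphism of $\mathcal{O}_2$ has this form. An extension of $\lambda_w$ is an element of $\operatorname{End}(\mathcal{Q}_2)$ whose restriction to $\mathcal{O}_2$ is $\lambda_w$. $B'\cap\mathcal{Q}_2$ is the relative commutant of $B$ in $\mathcal{Q}_2$. *)

(* Defs.v *)
From HB Require Import structures.
From mathcomp Require Import all_boot all_order all_algebra.
From mathcomp Require Import complex.
From mathcomp Require Import all_classical all_reals all_analysis.
Import Order.TTheory GRing.Theory Num.Theory.
Import numFieldNormedType.Exports.
Set Implicit Arguments.
Unset Strict Implicit.
Unset Printing Implicit Defensive.
Local Open Scope classical_set_scope.
Local Open Scope ring_scope.

(* The library's structures cannot be joined directly (normed modules and
   algebras meet in Num.NumDomain), so the norm is part of the mixin; it is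
   real-valued and completeness is stated with Cauchy sequences. *)
HB.mixin Record isCStarAlgebra (R : realType) A of GRing.Algebra R[i]%C A := {
  cnorm : A -> R ;
  star : A -> A ;
  cnormD : forall x y, cnorm (x + y) <= cnorm x + cnorm y ;
  cnormZ : forall (a : R[i]%C) x, cnorm (a *: x) = complex.Re `|a| * cnorm x ;
  cnorm_eq0 : forall x, cnorm x = 0 -> x = 0 ;
  cnormM : forall x y, cnorm (x * y) <= cnorm x * cnorm y ;
  cnorm_complete : forall x : nat -> A,
    (forall e : R, 0 < e -> exists N : nat, forall m n : nat,
       (N <= m)%N -> (N <= n)%N -> cnorm (x m - x n) < e) ->
    exists l : A, (fun n => cnorm (x n - l)) @ \oo --> (0 : R) ;
  starK : forall x, star (star x) = x ;
  starD : forall x y, star (x + y) = star x + star y ;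
  starZ : forall (a : R[i]%C) x, star (a *: x) = a^*%C *: star x ;
  starM : forall x y, star (x * y) = star y * star x ;
  cstar_identity : forall x, cnorm (star x * x) = cnorm x ^+ 2 }.

(* Unital (and, since algType excludes the zero ring, nonzero) complex
   C*-algebras. *)
#[short(type="cstarAlgType")]
HB.structure Definition CStarAlgebra (R : realType) :=
  { A of isCStarAlgebra R A & GRing.Algebra R[i]%C A }.

Section CStarBasics.
Context {R : realType}.
Implicit Types A B : cstarAlgType R.

Definition isometry A (x : A) : Prop := star x * x = 1.

Definition unitary A (x : A) : Prop := star x * x = 1 /\ x * star x = 1.

Definition norm_closed A (S : set A) : Prop :=
  forall x : A,
    (forall e : R, 0 < e -> exists2 y : A, S y & cnorm (x - y) < e) -> S x.

(* Not required to contain the unit of A. *)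
Record cstar_subalgebra A (S : set A) : Prop := CStarSubalgebra {
  csub0 : S 0 ;
  csubD : forall x y, S x -> S y -> S (x + y) ;
  csubZ : forall (a : R[i]%C) x, S x -> S (a *: x) ;
  csubM : forall x y, S x -> S y -> S (x * y) ;
  csub_star : forall x, S x -> S (star x) ;
  csub_closed : norm_closed S }.

(* C*(X) *)
Definition cstar_gen A (X : set A) : set A :=
  \bigcap_(S in [set S | cstar_subalgebra S /\ X `<=` S]) S.

(* X' \cap A *)
Definition commutant A (X : set A) : set A :=
  [set x | forall y, X y -> x * y = y * x].

(* Unital *-homomorphisms D -> B, where D is a *-subalgebra of A containing 1.
   Such a map is represented by a function on all of A whose values outside D
   are irrelevant. *)
Record star_hom_on A B (D : set A) (f : A -> B) : Prop := StarHomOn {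
  star_hom1 : f 1 = 1 ;
  star_homD : forall x y, D x -> D y -> f (x + y) = f x + f y ;
  star_homZ : forall (a : R[i]%C) x, D x -> f (a *: x) = a *: f x ;
  star_homM : forall x y, D x -> D y -> f (x * y) = f x * f y ;
  star_hom_star : forall x, D x -> f (star x) = star (f x) }.

(* End(D) *)
Definition star_endo A (D : set A) (f : A -> A) : Prop :=
  star_hom_on D f /\ f @` D `<=` D.

End CStarBasics.

Section TwoAdicRing.
Context {R : realType}.

Record Q2_relations (A : cstarAlgType R) (u s2 : A) : Prop := Q2Relations {
  Q2_unitary : unitary u ;
  Q2_isometry : isometry s2 ;
  Q2_comm : s2 * u = u ^+ 2 * s2 ;
  Q2_sum : s2 * star s2 + u * s2 * star s2 * star u = 1 }.

(* Q, with u and s2, is the 2-adic ring C*-algebra. *)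
Record is_Q2 (Q : cstarAlgType R) (u s2 : Q) : Prop := IsQ2 {
  Q2_rel : Q2_relations u s2 ;
  Q2_gen : cstar_gen [set u; s2] = setT ;
  Q2_univ : forall (B : cstarAlgType R) (v t2 : B), Q2_relations v t2 ->
    exists! f : Q -> B, [/\ star_hom_on setT f, f u = v & f s2 = t2] }.

Section Subalgebras.
Variables (Q : cstarAlgType R) (u s2 : Q).

(* The alphabet {1,2} is encoded as bool: true stands for 1, false for 2. *)
Definition s_ (b : bool) : Q := if b then u * s2 else s2.

Definition s_word (mu : seq bool) : Q := \prod_(b <- mu) s_ b.

Definition O2 : set Q := cstar_gen [set s_ true; s_ false].

Definition D2 : set Q :=
  cstar_gen [set s_word mu * star (s_word mu) | mu in [set: seq bool]].

Definition is_gauge (t : R[i]%C) (f : Q -> Q) : Prop :=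
  [/\ star_endo setT f, bijective f, f u = u & f s2 = t *: s2].

(* alpha_t, for |t| = 1; see gaugeP and gauge_unique. *)
Definition gauge (t : R[i]%C) : Q -> Q := xget (@id Q) [set f | is_gauge t f].

Definition F2 : set Q :=
  O2 `&` [set x | forall t : R[i]%C, `|t| = 1 -> gauge t x = x].

(* lam = lambda_w *)
Definition is_lambda (w : Q) (lam : Q -> Q) : Prop :=
  star_endo O2 lam /\ forall b : bool, lam (s_ b) = w * s_ b.

Definition is_extension (lam phi : Q -> Q) : Prop :=
  star_endo setT phi /\ forall x, O2 x -> phi x = lam x.

End Subalgebras.

Lemma star_hom_comp (A B C : cstarAlgType R) (g : B -> C) (f : A -> B) :
  star_hom_on setT g -> star_hom_on setT f -> star_hom_on setT (g \o f).
Proof.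
case=> g1 gD gZ gM gs [f1 fD fZ fM fs]; split => //= [|x y _ _|a x _|x y _ _|x _].
- by rewrite f1 g1.
- by rewrite fD // gD.
- by rewrite fZ // gZ.
- by rewrite fM // gM.
- by rewrite fs // gs.
Qed.

Lemma Q2_hom_ext (Q : cstarAlgType R) (u s2 : Q) (B : cstarAlgType R)
    (f g : Q -> B) : is_Q2 u s2 -> Q2_relations (f u) (f s2) ->
  star_hom_on setT f -> star_hom_on setT g ->
  f u = g u -> f s2 = g s2 -> f = g.
Proof.
case=> _ _ univ rel hf hg fu fs; have [h [_ hU]] := univ B _ _ rel.
by rewrite -(hU f) // -(hU g).
Qed.

Lemma Q2_relations_gauge (Q : cstarAlgType R) (u s2 : Q) (t : R[i]%C) :
  Q2_relations u s2 -> `|t| = 1 -> Q2_relations u (t *: s2).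
Proof.
case=> uu is2 com sum t1.
have tt : t * t^*%C = 1 by rewrite -sqr_normc t1 expr1n.
split=> //.
- by rewrite /isometry starZ -scalerAl -scalerAr scalerA [_^*%C * _]mulrC tt scale1r.
- by rewrite -scalerAl com scalerAr.
- by rewrite starZ -!(scalerAl, scalerAr) !scalerA [_^*%C * _]mulrC tt !scale1r.
Qed.

Lemma gauge_unique (Q : cstarAlgType R) (u s2 : Q) (t : R[i]%C) (f g : Q -> Q) :
  is_Q2 u s2 -> `|t| = 1 -> is_gauge u s2 t f -> is_gauge u s2 t g -> f = g.
Proof.
move=> hQ t1 [[hf _] _ fu fs] [[hg _] _ gu gs].
apply: (Q2_hom_ext hQ) => //; rewrite ?fu ?gu ?fs ?gs //.
exact: Q2_relations_gauge (Q2_rel hQ) t1.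
Qed.

Lemma gaugeP (Q : cstarAlgType R) (u s2 : Q) (t : R[i]%C) :
  is_Q2 u s2 -> `|t| = 1 -> is_gauge u s2 t (gauge u s2 t).
Proof.
move=> hQ t1; rewrite /gauge; case: xgetP => // /(_ _) nof; exfalso.
have tV1 : `|t^-1| = 1 by rewrite normfV t1 invr1.
have t0 : t != 0 by rewrite -normr_eq0 t1 oner_eq0.
have rel := Q2_rel hQ.
have [f [[hf fu fs] _]] := Q2_univ hQ (Q2_relations_gauge rel t1).
have [g [[hg gu gs] _]] := Q2_univ hQ (Q2_relations_gauge rel tV1).
have hid : star_hom_on setT (@id Q) by [].
apply: (nof f); split=> //.
exists g => x.
- have -> : g (f x) = (g \o f) x by [].
  rewrite (@Q2_hom_ext _ u s2 _ (g \o f) id) //=; first last.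
  + by rewrite fs (star_homZ hg) // gs scalerA mulfV // scale1r.
  + by rewrite fu gu.
  + exact: star_hom_comp.
  + by rewrite fu gu fs (star_homZ hg) // gs scalerA mulfV // scale1r.
- have -> : f (g x) = (f \o g) x by [].
  rewrite (@Q2_hom_ext _ u s2 _ (f \o g) id) //=; first last.
  + by rewrite gs (star_homZ hf) // fs scalerA mulVf // scale1r.
  + by rewrite gu fu.
  + exact: star_hom_comp.
  + by rewrite gu fu gs (star_homZ hf) // fs scalerA mulVf // scale1r.
Qed.

End TwoAdicRing.

(* Main.v *)
(* Let S_i = lam (s_i) and P_n = S_1^n S_1^{*n}. If phi and psi extend lam, then
   y = phi u - psi u satisfies y S_2 = 0 and y S_1 = S_2 y; so does y = x v - v x
   when v = phi u and x commutes with lam (O2). These relations give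
   y = S_2^n y S_1^{*n}, hence y P_n = y for all n, and both claims reduce to:
   the closed left ideal J of all such y is zero.

   Either condition on lam puts P_n in the Bunce-Deddens algebra B of gauge-fixed
   points, so J is invariant under the gauge action, and by Fejer summation J is
   zero as soon as it contains no nonzero gauge-homogeneous element. Those move
   into B by multiplication with s_2, s_2^* and s_1^*. On B, conjugation by
   diagonal unitaries gives a second grading, by the degree in u, whose components
   are D_2 u^k; a second Fejer summation reduces everything to D_2.
   - If lam (D_2) = D_2, an element of J in D_2 is lam d, where d p_n is close to
     a scalar multiple of p_n = s_1^n s_1^{*n}, and P_n <> P_{n+1}.
   - If lam (F_2) lies in F_2, then for z in J and x in B the element a = x z
     equals a P_n, and a has the same trace as each of 2^n orthogonal translates of
     P_n a P_n by the partial isometries lam (s_mu s_nu^* ), whose sum has norm at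
     most that of a. Hence a has trace at most 2^{-n} |a| for all n, that is, trace
     zero, and the trace is faithful on D_2. *)
Require Import Defs.
From mathcomp Require Import all_boot all_order all_algebra.
From mathcomp Require Import complex.
From mathcomp Require Import all_classical all_reals all_analysis.
From mathcomp Require Import ring lra zify.
Import Order.TTheory GRing.Theory Num.Theory.
Import numFieldNormedType.Exports.
Set Implicit Arguments.
Unset Strict Implicit.
Unset Printing Implicit Defensive.
Local Open Scope classical_set_scope.
Local Open Scope ring_scope.

(** * Norms and closed subspaces *)

Section Norm.
Context {R : realType} {A : cstarAlgType R}.
Implicit Types (x y : A) (a : R[i]%C).
Local Notation N := (@cnorm R A).

Lemma star0 : star (0 : A) = 0.
Proof. by rewrite -(scale0r (0 : A)) starZ conjc0 !scale0r. Qed.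

Lemma starN x : star (- x) = - star x.
Proof. by apply/eqP; rewrite -addr_eq0 -starD addNr star0 eqxx. Qed.

Lemma starB x y : star (x - y) = star x - star y.
Proof. by rewrite starD starN. Qed.

Lemma star1 : star (1 : A) = 1.
Proof. by rewrite -[LHS]mulr1 -{2}(starK 1) -starM mulr1 starK. Qed.

Lemma star_sum (I : Type) (r : seq I) (P : pred I) (F : I -> A) :
  star (\sum_(i <- r | P i) F i) = \sum_(i <- r | P i) star (F i).
Proof. exact: (big_morph _ starD star0). Qed.

Lemma starX x n : star (x ^+ n) = star x ^+ n.
Proof. by elim: n => [|n IH]; rewrite ?expr0 ?star1 // exprS starM IH exprSr. Qed.

Lemma cnorm0 : N 0 = 0.
Proof. by rewrite -(scale0r (0 : A)) cnormZ normr0 mul0r. Qed.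

Lemma cnormN x : N (- x) = N x.
Proof. by rewrite -scaleN1r cnormZ normrN1 mul1r. Qed.

Lemma cnorm_ge0 x : 0 <= N x.
Proof. by have := cnormD x (- x); rewrite subrr cnorm0 cnormN; lra. Qed.

Lemma cnormB x y : N (x - y) <= N x + N y.
Proof. by rewrite -(cnormN y) cnormD. Qed.

Lemma cnorm_distC x y : N (x - y) = N (y - x).
Proof. by rewrite -cnormN opprB. Qed.

Lemma cnorm_dist_trans z x y : N (x - y) <= N (x - z) + N (z - y).
Proof.
by have -> : x - y = (x - z) + (z - y); [rewrite addrA subrK | exact: cnormD].
Qed.

Lemma cnorm_sum (I : Type) (r : seq I) (P : pred I) (F : I -> A) :
  N (\sum_(i <- r | P i) F i) <= \sum_(i <- r | P i) N (F i).
Proof.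
elim/big_rec2: _ => [|i y1 y2 _ le12]; first by rewrite cnorm0.
by rewrite (le_trans (cnormD _ _)) ?lerD2l.
Qed.

Lemma cnorm_small x : (forall e, 0 < e -> N x <= e) -> x = 0.
Proof.
move=> sm; apply: cnorm_eq0; apply/eqP; rewrite eq_le cnorm_ge0 andbT.
by apply/ler_addgt0Pl => e e0; rewrite addr0 sm.
Qed.

Lemma cnorm_star x : N (star x) = N x.
Proof.
have le y : N y <= N (star y).
  have [->|y0] := eqVneq (N y) 0; first exact: cnorm_ge0.
  have yp : 0 < N y by rewrite lt_def y0 cnorm_ge0.
  by rewrite -(ler_pM2r yp) -expr2 -cstar_identity cnormM.
by apply/eqP; rewrite eq_le le -{2}(starK x) le.
Qed.

Lemma cnorm1 : N 1 = 1.
Proof.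
have /eqP : N 1 = N 1 ^+ 2 by rewrite -cstar_identity star1 mulr1.
rewrite -subr_eq0 expr2 -{1}[N 1]mulr1 -mulrBr mulf_eq0 => /orP[/eqP /cnorm_eq0|].
  by move/eqP; rewrite oner_eq0.
by rewrite subr_eq0 => /eqP.
Qed.

Lemma cnorm_isometry x : Defs.isometry x -> N x = 1.
Proof.
move=> hx; have := cstar_identity x; rewrite hx cnorm1 => /esym/eqP.
by rewrite sqrf_eq1 => /orP[/eqP //|/eqP h]; have := cnorm_ge0 x; lra.
Qed.

Lemma cnorm_unitary x : unitary x -> N x = 1.
Proof. by case=> /cnorm_isometry. Qed.

Lemma star_mul_eq0 x : star x * x = 0 -> x = 0.
Proof.
move=> h; apply: cnorm_eq0; have := cstar_identity x.
by rewrite h cnorm0 => /esym/eqP; rewrite sqrf_eq0 => /eqP.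
Qed.

Lemma cnorm_mulr_le x y : N y <= 1 -> N (x * y) <= N x.
Proof. by move=> y1; rewrite (le_trans (cnormM _ _)) // ler_piMr ?cnorm_ge0. Qed.

Lemma cnorm_mull_le x y : N x <= 1 -> N (x * y) <= N y.
Proof. by move=> x1; rewrite (le_trans (cnormM _ _)) // ler_piMl ?cnorm_ge0. Qed.

Lemma starX_mulX x n : star x * x = 1 -> star x ^+ n * x ^+ n = 1.
Proof.
move=> xx; elim: n => [|n IH]; first by rewrite mul1r.
by rewrite exprSr exprS mulrA -(mulrA (star x ^+ n)) xx mulr1.
Qed.

End Norm.

(** * Closed subspaces and closed linear spans *)

Section Subspaces.
Context {R : realType} {A : cstarAlgType R}.
Implicit Types (x y : A) (a : R[i]%C) (S T : set A) (f : A -> A).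
Local Notation N := (@cnorm R A).

Lemma Re_norm_ge0 a : 0 <= complex.Re `|a|.
Proof. by have := normr_ge0 a; rewrite lecE => /andP[_]. Qed.

Lemma cnormZ1 a x : `|a| = 1 -> N (a *: x) = N x.
Proof. by move=> a1; rewrite cnormZ a1 mul1r. Qed.

Lemma cnormZn n x : N ((n%:R : R[i]%C) *: x) = n%:R * N x.
Proof. by rewrite cnormZ normr_nat -(rmorph_nat (real_complex R)). Qed.

Lemma cnormZVn n x : N ((n%:R^-1 : R[i]%C) *: x) = n%:R^-1 * N x.
Proof. by rewrite cnormZ normfV normr_nat -(rmorph_nat (real_complex R)) -fmorphV. Qed.

Record closed_subspace S : Prop := ClosedSubspace {
  clsub0 : S 0 ;
  clsubD : forall x y, S x -> S y -> S (x + y) ;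
  clsubZ : forall a x, S x -> S (a *: x) ;
  clsub_closed : norm_closed S }.

Lemma clsubN S x : closed_subspace S -> S x -> S (- x).
Proof. by move=> cS Sx; rewrite -scaleN1r; apply: clsubZ. Qed.

Lemma clsubB S x y : closed_subspace S -> S x -> S y -> S (x - y).
Proof. by move=> cS Sx Sy; apply: clsubD => //; apply: clsubN. Qed.

Lemma clsub_sum S (I : eqType) (r : seq I) (P : pred I) (F : I -> A) :
  closed_subspace S -> (forall i, i \in r -> P i -> S (F i)) ->
  S (\sum_(i <- r | P i) F i).
Proof.
move=> cS SF; rewrite big_seq_cond; elim/big_ind: _; first exact: clsub0.
- exact: clsubD.
- by move=> i /andP[]; apply: SF.
Qed.

Lemma cstar_subalgebra_closed S : cstar_subalgebra S -> closed_subspace S.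
Proof. by case. Qed.

(** Defined as an intersection, so that a property of the closed span follows once it cuts out a
    closed subspace and holds on the generators; most density arguments below have this form. *)
Definition cspan S : set A :=
  \bigcap_(T in [set T | closed_subspace T /\ S `<=` T]) T.

Lemma cspan_closed S : closed_subspace (cspan S).
Proof.
split.
- by move=> T [cT _]; apply: clsub0.
- by move=> x y Sx Sy T [cT ST]; apply: clsubD => //; [apply: Sx|apply: Sy].
- by move=> a x Sx T [cT ST]; apply: clsubZ => //; apply: Sx.
- move=> x Hx T [cT ST]; apply: (clsub_closed cT) => e /Hx[y Sy ?].
  by exists y => //; apply: Sy.
Qed.

Lemma cspan_sub S : S `<=` cspan S.
Proof. by move=> x Sx T [_]; apply. Qed.

Lemma cspan_min S T : closed_subspace T -> S `<=` T -> cspan S `<=` T.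
Proof. by move=> cT ST x; apply. Qed.

Lemma cspan_mono S T : S `<=` T -> cspan S `<=` cspan T.
Proof.
by move=> ST; apply: cspan_min (cspan_closed T) _ => x /ST; apply: cspan_sub.
Qed.

(** * Bounded linear operators and the closed subspaces they define *)

Record bounded_op f : Prop := BoundedOp {
  bopD : forall x y, f (x + y) = f x + f y ;
  bopZ : forall a x, f (a *: x) = a *: f x ;
  bop_bound : exists2 C : R, 0 < C & forall x, N (f x) <= C * N x }.

Lemma bop0 f : bounded_op f -> f 0 = 0.
Proof. by move=> bf; rewrite -(scale0r (0 : A)) (bopZ bf) !scale0r. Qed.

Lemma bopB f x y : bounded_op f -> f (x - y) = f x - f y.
Proof. by move=> bf; rewrite (bopD bf) -scaleN1r (bopZ bf) scaleN1r. Qed.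

Lemma bop_sum f (I : Type) (r : seq I) (P : pred I) (F : I -> A) :
  bounded_op f -> f (\sum_(i <- r | P i) F i) = \sum_(i <- r | P i) f (F i).
Proof. by move=> bf; apply: (big_morph f (bopD bf) (bop0 bf)). Qed.

Lemma bop_contraction f : (forall x y, f (x + y) = f x + f y) ->
  (forall a x, f (a *: x) = a *: f x) -> (forall x, N (f x) <= N x) ->
  bounded_op f.
Proof. by move=> fD fZ fN; split=> //; exists 1 => // x; rewrite mul1r. Qed.

Lemma bop_id : bounded_op id.
Proof. exact: bop_contraction. Qed.

Lemma bop_comp f g : bounded_op f -> bounded_op g -> bounded_op (f \o g).
Proof.
move=> bf bg; split=> [x y|a x|] /=.
- by rewrite (bopD bg) (bopD bf).
- by rewrite (bopZ bg) (bopZ bf).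
- have [C C0 fC] := bop_bound bf; have [D D0 gD] := bop_bound bg.
  exists (C * D) => [|x]; first exact: mulr_gt0.
  by rewrite (le_trans (fC _)) // -mulrA ler_pM2l.
Qed.

Lemma bop_mull y : bounded_op (fun x => y * x).
Proof.
split=> [x z|a x|]; rewrite ?mulrDr ?scalerAr //.
exists (N y + 1) => [|x]; first by have := cnorm_ge0 y; lra.
by rewrite (le_trans (cnormM _ _)) // ler_wpM2r ?cnorm_ge0 //; lra.
Qed.

Lemma bop_mulr y : bounded_op (fun x => x * y).
Proof.
split=> [x z|a x|]; rewrite ?mulrDl ?scalerAl //.
exists (N y + 1) => [|x]; first by have := cnorm_ge0 y; lra.
by rewrite (le_trans (cnormM _ _)) // mulrC ler_wpM2r ?cnorm_ge0 //; lra.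
Qed.

Lemma bop_sub f g : bounded_op f -> bounded_op g -> bounded_op (fun x => f x - g x).
Proof.
move=> bf bg; split=> [x y|a x|].
- by rewrite (bopD bf) (bopD bg) opprD addrACA.
- by rewrite (bopZ bf) (bopZ bg) scalerBr.
- have [C C0 fC] := bop_bound bf; have [D D0 gD] := bop_bound bg.
  exists (C + D) => [|x]; first exact: addr_gt0.
  by rewrite (le_trans (cnormB _ _)) // mulrDl lerD.
Qed.

Lemma clsub_preim f S : bounded_op f -> closed_subspace S ->
  closed_subspace [set x | S (f x)].
Proof.
move=> bf cS; split=> /=.
- by rewrite (bop0 bf); apply: clsub0.
- by move=> x y Sx Sy; rewrite (bopD bf); apply: clsubD.
- by move=> a x Sx; rewrite (bopZ bf); apply: clsubZ.
- move=> x Hx; have [C C0 fC] := bop_bound bf.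
  apply: (clsub_closed cS) => e e0; have [|y Sy xy] := Hx (e / C).
    exact: divr_gt0.
  exists (f y) => //; rewrite -(bopB _ _ bf) (le_lt_trans (fC _)) //.
  by rewrite mulrC -ltr_pdivlMr.
Qed.

Lemma clsub_preim_star S : closed_subspace S -> closed_subspace [set x | S (star x)].
Proof.
move=> cS; split=> /=.
- by rewrite star0; apply: clsub0.
- by move=> x y Sx Sy; rewrite starD; apply: clsubD.
- by move=> a x Sx; rewrite starZ; apply: clsubZ.
- move=> x Hx; apply: (clsub_closed cS) => e /Hx[y Sy xy].
  by exists (star y) => //; rewrite -starB cnorm_star.
Qed.

Lemma clsub_zero : closed_subspace [set (0 : A)].
Proof.
split=> /=; first by [].
- by move=> x y -> ->; rewrite addr0.
- by move=> a x ->; rewrite scaler0.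
- move=> x Hx; apply: cnorm_small => e /Hx[_ ->].
  by rewrite subr0 => /ltW.
Qed.

Lemma clsub_ker f : bounded_op f -> closed_subspace [set x | f x = 0].
Proof. by move=> bf; apply: clsub_preim clsub_zero. Qed.

Lemma clsub_eq f g : bounded_op f -> bounded_op g ->
  closed_subspace [set x | f x = g x].
Proof.
move=> bf bg; have := clsub_ker (bop_sub bf bg); congr (closed_subspace _).
by apply/seteqP; split=> x /=; [move/subr0_eq | move->; rewrite subrr].
Qed.

Lemma clsub_bigcap (I : Type) (F : I -> set A) :
  (forall i, closed_subspace (F i)) -> closed_subspace [set x | forall i, F i x].
Proof.
move=> cF; split=> /=.
- by move=> i; apply: clsub0.
- by move=> x y Fx Fy i; apply: clsubD.
- by move=> a x Fx i; apply: clsubZ.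
- move=> x Hx i; apply: (clsub_closed (cF i)) => e /Hx[y Fy ?].
  by exists y.
Qed.

(** A conclusion under a premise is an intersection indexed by the proofs of the premise. *)
Lemma clsub_imply (P : Prop) S : closed_subspace S ->
  closed_subspace [set x | P -> S x].
Proof. by move=> cS; apply: (@clsub_bigcap P (fun=> S)). Qed.

Lemma clsub_setI S T : closed_subspace S -> closed_subspace T ->
  closed_subspace (S `&` T).
Proof.
move=> cS cT; have -> : S `&` T = [set x | forall b : bool, (if b then S else T) x].
  by apply/seteqP; split=> x /= => [[? ?] [] //|h]; split; [apply: (h true)|apply: (h false)].
by apply: clsub_bigcap => -[].
Qed.

Lemma cspan_map f S T : bounded_op f -> closed_subspace T ->
  (forall x, S x -> T (f x)) -> forall x, cspan S x -> T (f x).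
Proof. by move=> bf cT ST; apply: cspan_min => //; apply: clsub_preim. Qed.

Lemma cspan_map2 (g : A -> A -> A) S S' T :
  (forall x, bounded_op (g x)) -> (forall y, bounded_op (g^~ y)) ->
  closed_subspace T -> (forall x y, S x -> S' y -> T (g x y)) ->
  forall x y, cspan S x -> cspan S' y -> T (g x y).
Proof.
move=> bl br cT h x y Sx Sy.
apply: (@cspan_map (g^~ y) S T) => // {}x {}Sx.
by apply: (@cspan_map (g x) S' T) => // {Sy}y Sy; apply: h.
Qed.

Lemma cspan_subalgebra S : (forall x, S x -> S (star x)) ->
  (forall x y, S x -> S y -> cspan S (x * y)) -> cstar_subalgebra (cspan S).
Proof.
move=> Sst SM; have cS := cspan_closed S.
split; try by case: cS.
- move=> x y; apply: (@cspan_map2 (fun x y => x * y)) => //.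
  + exact: bop_mull.
  + exact: bop_mulr.
- by apply: cspan_min; [exact: clsub_preim_star | move=> x /Sst; apply: cspan_sub].
Qed.

Lemma cstar_gen_subalgebra S : cstar_subalgebra (cstar_gen S).
Proof.
split.
- by move=> T [sT _]; apply: csub0.
- by move=> x y Sx Sy T ST; apply: (csubD ST.1); [apply: Sx | apply: Sy].
- by move=> a x Sx T ST; apply: (csubZ ST.1); apply: Sx.
- by move=> x y Sx Sy T ST; apply: (csubM ST.1); [apply: Sx | apply: Sy].
- by move=> x Sx T ST; apply: (csub_star ST.1); apply: Sx.
- move=> x Hx T ST; apply: (csub_closed ST.1) => e /Hx[y Sy xy].
  by exists y => //; apply: Sy.
Qed.

(** * Limits of sequences *)

Definition tends (x : nat -> A) (l : A) : Prop :=
  forall e : R, 0 < e -> exists n0 : nat, forall n, (n0 <= n)%N -> N (x n - l) < e.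

Lemma tendsD (x y : nat -> A) l m : tends x l -> tends y m -> tends (fun n => x n + y n) (l + m).
Proof.
move=> xl ym e e0; have e2 : 0 < e / 2 by lra.
have [n1 h1] := xl _ e2; have [n2 h2] := ym _ e2.
exists (maxn n1 n2) => n; rewrite geq_max => /andP[/h1 a1 /h2 a2].
rewrite opprD addrACA (le_lt_trans (cnormD _ _)) //; lra.
Qed.

Lemma tends_bop f (x : nat -> A) l : bounded_op f -> tends x l -> tends (fun n => f (x n)) (f l).
Proof.
move=> bf xl e e0; have [C C0 fC] := bop_bound bf.
have [|n0 h] := xl (e / C); first exact: divr_gt0.
exists n0 => n /h; rewrite -(bopB _ _ bf) ltr_pdivlMr // mulrC => h'.
exact: le_lt_trans h'.
Qed.

Lemma bop_scale a : bounded_op ( *:%R a).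
Proof.
split=> [x y|b x|]; rewrite ?scalerDr ?scalerA 1?mulrC //.
exists (complex.Re `|a| + 1) => [|x]; first by have := Re_norm_ge0 a; lra.
by rewrite cnormZ ler_wpM2r ?cnorm_ge0 //; lra.
Qed.

Lemma tends_eventually (x : nat -> A) l n0 : (forall n, (n0 <= n)%N -> x n = l) -> tends x l.
Proof. by move=> h e e0; exists n0 => n /h ->; rewrite subrr cnorm0. Qed.

Lemma tends_cst l : tends (fun=> l) l.
Proof. exact: (@tends_eventually _ _ 0). Qed.

Lemma tends_sum (I : Type) (r : seq I) (x : I -> nat -> A) (l : I -> A) :
  (forall i, tends (x i) (l i)) ->
  tends (fun n => \sum_(i <- r) x i n) (\sum_(i <- r) l i).
Proof.
move=> h; elim: r => [|i r IH]; first by apply: (@tends_eventually _ _ 0) => n _; rewrite !big_nil.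
under eq_fun do rewrite big_cons; rewrite big_cons; exact: tendsD.
Qed.

Lemma tends_unique (x : nat -> A) l m : tends x l -> tends x m -> l = m.
Proof.
move=> xl xm; apply/subr0_eq/cnorm_small => e e0; have e2 : 0 < e / 2 by lra.
have [n1 h1] := xl _ e2; have [n2 h2] := xm _ e2.
have := h1 _ (leq_maxl n1 n2); have := h2 _ (leq_maxr n1 n2).
move: (x _) => z zm zl; rewrite (le_trans (cnorm_dist_trans z _ _)) // cnorm_distC; lra.
Qed.

Lemma tends_closed S (x : nat -> A) l : closed_subspace S -> (forall n, S (x n)) -> tends x l -> S l.
Proof.
move=> cS Sx xl; apply: (clsub_closed cS) => e /xl[n0 /(_ _ (leqnn _))].
by exists (x n0); rewrite // cnorm_distC.
Qed.

Lemma cauchy_tends (x : nat -> A) :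
  (forall e : R, 0 < e -> exists n0 : nat, forall m n,
    (n0 <= m)%N -> (n0 <= n)%N -> N (x m - x n) < e) -> exists l, tends x l.
Proof.
move=> /cnorm_complete[l xl]; exists l => e e0.
have /cvgrPdist_lt /(_ e e0) := xl.
case=> n0 _ h; exists n0 => n /h /=.
by rewrite sub0r normrN ger0_norm // cnorm_ge0.
Qed.

(** Since the operators are uniformly contractive, convergence passes to norm limits: [T n x] is
    Cauchy by comparison with [T n y] for y near x, and the limits are as close as x and y are.
    Convergence thus needs checking on generators only. *)
Lemma clsub_tends (T : nat -> A -> A) S :
  (forall n, bounded_op (T n)) -> (forall n x, N (T n x) <= N x) ->
  closed_subspace S -> closed_subspace [set x | exists2 l, S l & tends (T^~ x) l].
Proof.
move=> bT TN cS; split=> /=.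
- exists 0; first exact: clsub0.
  by apply: (@tends_eventually _ _ 0) => n _; rewrite (bop0 (bT n)).
- move=> x y [l Sl xl] [m Sm ym]; exists (l + m); first exact: clsubD.
  by under eq_fun do rewrite (bopD (bT _)); apply: tendsD.
- move=> a x [l Sl xl]; exists (a *: l); first exact: clsubZ.
  by under eq_fun do rewrite (bopZ (bT _)); apply: tends_bop => //; apply: bop_scale.
- move=> x Hx.
  have [l xl] : exists l, tends (T^~ x) l.
    apply: cauchy_tends => e e0.
    have [|y [l Sl yl] xy] := Hx (e / 4); first lra.
    have [|n0 h] := yl (e / 4); first lra.
    exists n0 => m n /h am /h an.
    have dm := TN m (x - y); have dn := TN n (x - y).
    rewrite (bopB _ _ (bT _)) in dm; rewrite (bopB _ _ (bT _)) in dn.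
    have := cnorm_dist_trans (T m y) (T m x) (T n x).
    have := cnorm_dist_trans l (T m y) (T n x).
    have := cnorm_dist_trans (T n y) l (T n x).
    rewrite (cnorm_distC l (T n y)) (cnorm_distC (T n y) (T n x)); lra.
  exists l => //; apply: (clsub_closed cS) => e e0.
  have [|y [m Sm ym] xy] := Hx (e / 3); first lra.
  exists m => //.
  have [|n1 h1] := ym (e / 3); first lra.
  have [|n2 h2] := xl (e / 3); first lra.
  have := h1 _ (leq_maxl n1 n2); have := h2 _ (leq_maxr n1 n2).
  set n := maxn _ _ => a2 a1.
  have dn := TN n (x - y); rewrite (bopB _ _ (bT _)) in dn.
  have := cnorm_dist_trans (T n x) l m.
  have := cnorm_dist_trans (T n y) (T n x) m.
  rewrite (cnorm_distC l (T n x)); lra.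
Qed.

Lemma clsub_tends0 (T : nat -> A -> A) :
  (forall n, bounded_op (T n)) -> (forall n x, N (T n x) <= N x) ->
  closed_subspace [set x | tends (T^~ x) 0].
Proof.
move=> bT TN; have := clsub_tends bT TN clsub_zero; congr closed_subspace.
by apply/seteqP; split=> x /=; [move=> [_ ->] | move=> h; exists 0].
Qed.

End Subspaces.

(** * Contractivity of unital *-homomorphisms *)

Section Contraction.
Context {R : realType}.
Local Notation N := cnorm.

Lemma geometric_tends (A : cstarAlgType R) (r : R) (b : nat -> A) :
  0 <= r < 1 -> (forall n, N (b n.+1 - b n) <= r ^+ n) -> exists l, tends b l.
Proof.
move=> /andP[r0 r1] br; have r'0 : 0 < 1 - r by lra.
have step n k : N (b (n + k)%N - b n) <= r ^+ n / (1 - r).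
  apply: (@le_trans _ _ ((r ^+ n - r ^+ (n + k)) / (1 - r))); last first.
    by rewrite ler_pM2r ?invr_gt0 // gerBl exprn_ge0.
  elim: k => [|k IH]; first by rewrite addn0 !subrr cnorm0 mul0r.
  rewrite (le_trans (cnorm_dist_trans (b (n + k)%N) _ _)) //.
  have -> : (r ^+ n - r ^+ (n + k.+1)) / (1 - r) =
     r ^+ (n + k) + (r ^+ n - r ^+ (n + k)) / (1 - r).
    rewrite addnS exprS; field; lra.
  by rewrite lerD // addnS.
apply: cauchy_tends => e e0.
have /cvgrPdist_lt /(_ (e * (1 - r) / 2)) : (fun n => r ^+ n) @ \oo --> (0 : R).
  by apply: cvg_expr; rewrite ger0_norm.
case=> [|n0 _ h]; first by rewrite divr_gt0 ?mulr_gt0.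
have {}h k : N (b (n0 + k)%N - b n0) < e / 2.
  have := h n0 (leqnn _); rewrite /= sub0r normrN ger0_norm ?exprn_ge0 // => h'.
  rewrite (le_lt_trans (step _ _)) // ltr_pdivrMr //; lra.
exists n0 => m n /subnKC <- /subnKC <-.
have := cnorm_dist_trans (b n0) (b (n0 + (m - n0))%N) (b (n0 + (n - n0))%N).
have := h (m - n0)%N; have := h (n - n0)%N.
rewrite (cnorm_distC (b n0)); lra.
Qed.

(* [k = sqrt (1 - h^2)] is [1 - b] for [b] the fixed point of
   [b |-> (h^2 + b^2) / 2], a contraction on a small ball. *)
Lemma exists_sqrt_one_sub_sqr (A : cstarAlgType R) (D : set A) (h : A) :
  cstar_subalgebra D -> D 1 -> D h -> star h = h -> N h < 1 ->
  exists k, [/\ D k, star k = k, h * k = k * h & h * h + k * k = 1].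
Proof.
move=> sD D1 Dh hs h1; have cD := cstar_subalgebra_closed sD.
pose f (b : A) := (2^-1 : R[i]%C) *: (h * h + b * b).
pose b n := iter n f 0.
have bS n : b n.+1 = f (b n) by [].
have h0 : 0 <= N h by apply: cnorm_ge0.
(* The ball of radius |h| is stable because |h|^2 <= |h|. *)
have Nf x : N x <= N h -> N (f x) <= N h.
  move=> xh; rewrite /f cnormZVn mulrC ler_pdivrMr //.
  have := cnormD (h * h) (x * x); have := cnormM h h; have := cnormM x x.
  have := cnorm_ge0 x; nra.
have bN n : N (b n) <= N h.
  by elim: n => [|n IH]; [rewrite cnorm0 | rewrite bS Nf].
have bc n y : y * h = h * y -> y * b n = b n * y.
  move=> yh; elim: n => [|n IH]; first by rewrite mulr0 mul0r.
  rewrite bS /f -scalerAl -scalerAr mulrDl mulrDr; congr (_ *: (_ + _)).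
    by rewrite mulrA yh -!mulrA yh.
  by rewrite mulrA IH -!mulrA IH.
have bh n : h * b n = b n * h by apply: bc.
have bb m n : b m * b n = b n * b m by rewrite bc // bh.
have bs n : star (b n) = b n.
  elim: n => [|n IH]; first by rewrite star0.
  by rewrite bS /f starZ starD !starM hs IH conjc_inv conjc_nat.
have bD n : D (b n).
  elim: n => [|n IH]; first exact: csub0.
  by rewrite bS /f; apply: csubZ => //; apply: csubD => //; apply: csubM.
have [l bl] : exists l, tends b l.
  apply: (@geometric_tends _ (N h)) => [|n]; first by rewrite h0.
  elim: n => [|n IH].
    by rewrite subr0 expr0 (le_trans (bN 1%N)) // ltW.
  (* A difference of squares of commuting elements: (b_{n+1} + b_n) / 2 has norm at most |h|, which
     is the contraction ratio. *)
  rewrite exprS (_ : b n.+2 - b n.+1 =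
      (2^-1 : R[i]%C) *: ((b n.+1 - b n) * (b n.+1 + b n))).
    rewrite cnormZVn mulrC ler_pdivrMr //.
    have := cnormM (b n.+1 - b n) (b n.+1 + b n).
    have := cnormD (b n.+1) (b n); have := bN n; have := bN n.+1.
    have := cnorm_ge0 (b n.+1 - b n); move: IH; nra.
  rewrite {1}bS {2}bS /f -scalerBr opprD addrACA subrr add0r; congr (_ *: _).
  by rewrite mulrBl !mulrDr (bb n.+1 n) opprD addrA addrK.
have lh : h * l = l * h.
  have := tends_closed (clsub_eq (bop_mull h) (bop_mulr h)) bh bl; exact.
have Dl : D l by apply: tends_closed bl.
have ls : star l = l.
  apply: tends_unique (bl) => e /bl[n0 H]; exists n0 => n /H.
  by rewrite -{2}bs -starB cnorm_star.
have lf : l = f l.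
  apply: (@tends_unique _ _ (fun n => b n.+1)).
    by move=> e /bl[n0 H]; exists n0 => n n0n; apply: H; rewrite ltnW.
  apply: (@tends_bop _ _ _ (fun n => h * h + b n * b n)); first exact: bop_scale.
  apply: tendsD; first exact: tends_cst.
  move=> e e0; have d0 : 0 < N h + N l + 1 by have := cnorm_ge0 l; lra.
  have [|n0 H] := bl (e / (N h + N l + 1)); first by rewrite divr_gt0.
  exists n0 => n /H; rewrite ltr_pdivlMr // => lt.
  have -> : b n * b n - l * l = b n * (b n - l) + (b n - l) * l.
    by rewrite mulrBl mulrBr addrA subrK.
  rewrite (le_lt_trans (cnormD _ _)) // (le_lt_trans _ lt) //.
  have := cnormM (b n) (b n - l); have := cnormM (b n - l) l.
  have := bN n; have := cnorm_ge0 (b n - l); nra.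
exists (1 - l); split.
- exact: clsubB.
- by rewrite starB star1 ls.
- by rewrite mulrBl mulrBr mul1r mulr1 lh.
(* The fixed point equation reads h^2 = 2 l - l^2 = 1 - (1 - l)^2. *)
- have e : h * h = l + (l - l * l).
    apply/(addIr (l * l)); rewrite addrA subrK -mulr2n -scaler_nat {3}lf /f.
    by rewrite scalerA mulfV ?scale1r // pnatr_eq0.
  rewrite mulrBl mul1r mulrBr mulr1 e addrACA addrC subrr add0r.
  by rewrite addrCA subrr addr0.
Qed.

(* [g + i c] is unitary and [g] is the mean of it and its adjoint. *)
Lemma cnorm_le1_of_sqrt (B : cstarAlgType R) (g c : B) :
  star g = g -> star c = c -> g * c = c * g -> g * g + c * c = 1 -> N g <= 1.
Proof.
move=> gs cs gc gcc; pose U := g + 'i%C *: c.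
have ci : 'i^*%C = - 'i%C :> R[i]%C by apply/eqP; rewrite eq_complex /= oppr0 !eqxx.
have ii : 'i%C * 'i%C = -1 :> R[i]%C by rewrite -expr2 sqr_i.
have sU : star U = g - 'i%C *: c by rewrite starD starZ gs cs ci scaleNr.
have NU : N U = 1.
  apply: cnorm_isometry; rewrite /Defs.isometry sU /U mulrDr !mulrBl.
  rewrite -!scalerAl -!scalerAr gc scalerA ii.
  by rewrite scaleN1r opprK addrA subrK.
have : N (U + star U) <= 2.
  by rewrite (le_trans (cnormD _ _)) // cnorm_star NU.
rewrite sU /U addrACA subrr addr0 -mulr2n -scaler_nat cnormZn; lra.
Qed.

(** For self-adjoint h with |h| < 1 the equation h^2 + k^2 = 1 is solvable inside D and is carried
    over by f, so |f h| <= 1. Scaling treats all self-adjoint elements, and the C^*-identity for x^*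
    x treats the rest. *)
Lemma star_hom_contraction (A B : cstarAlgType R) (D : set A) (f : A -> B) :
  cstar_subalgebra D -> D 1 -> star_hom_on D f ->
  forall x, D x -> N (f x) <= N x.
Proof.
move=> sD D1 hf; have unit_ball h : D h -> star h = h -> N h < 1 -> N (f h) <= 1.
  move=> Dh hs h1; have [k [Dk ks hk hkk]] := exists_sqrt_one_sub_sqr sD D1 Dh hs h1.
  apply: (@cnorm_le1_of_sqrt _ (f h) (f k)).
  - by rewrite -(star_hom_star hf) ?hs.
  - by rewrite -(star_hom_star hf) ?ks.
  - by rewrite -!(star_homM hf) ?hk.
  - rewrite -!(star_homM hf) // -(star_homD hf) ?hkk ?(star_hom1 hf) //;
    exact: csubM.
move=> x Dx; have Dxx : D (star x * x) by apply: csubM => //; apply: csub_star.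
suff : N (f (star x * x)) <= N (star x * x).
  rewrite (star_homM hf) ?(star_hom_star hf) //; last exact: csub_star.
  by rewrite !cstar_identity ler_pXn2r ?nnegrE ?cnorm_ge0.
(* Division by |a| + e makes the norm strictly less than 1, as the square root requires. *)
apply/ler_addgt0Pr => e e0; set a := star x * x.
pose r := N a + e; have r0 : 0 < r by have := cnorm_ge0 a; rewrite /r; lra.
have NZ (C : cstarAlgType R) (y : C) : N ((r^-1)%:C%C *: y) = r^-1 * N y.
  by rewrite cnormZ normc_def /= expr0n addr0 sqrtr_sqr ger0_norm // invr_ge0 ltW.
have : N (f ((r^-1)%:C%C *: a)) <= 1.
  apply: unit_ball; first exact: csubZ.
  - by rewrite starZ conjc_real /a starM starK.
  - by rewrite NZ mulrC ltr_pdivrMr // mul1r /r; lra.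
by rewrite (star_homZ hf) // NZ mulrC ler_pdivrMr // mul1r.
Qed.

End Contraction.

(** * Fejer means over dyadic roots of unity *)

Section DyadicRoots.
Context {R : realType}.
Local Notation C := R[i]%C.

(** Finite averages over the powers of these roots take the place of integrals over the circle. *)
Definition dyadic_root (n : nat) : C := if n is m.+1 then iter m sqrtC (-1) else 1.

(** The order divides 2^n, and for n > 0 it is no smaller power of 2 because the 2^(n-1)-th power is
    -1. *)
Lemma dyadic_root_prim n : (2 ^ n).-primitive_root (dyadic_root n).
Proof.
case: n => [|n]; first by apply/andP; split=> //; apply/forallP => i; rewrite ord1 unity_rootE expr1n eqxx.
have half : dyadic_root n.+1 ^+ (2 ^ n) = -1.
  elim: n => [|n IH] //; rewrite expnS exprM /= sqrtCK; exact: IH.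
have one : dyadic_root n.+1 ^+ (2 ^ n.+1) = 1.
  by rewrite expnSr exprM half sqrrN expr1n.
have [//|m prim mdvd] := prim_order_exists _ one; first by rewrite expn_gt0.
have /(dvdn_pfactor _ _ (isT : prime 2))[l ln mE] := mdvd.
move: ln; rewrite leq_eqVlt => /orP[/eqP le|ln]; first by move: prim; rewrite mE le.
have : dyadic_root n.+1 ^+ (2 ^ n) == 1.
  by rewrite -(prim_order_dvd prim) mE dvdn_exp2l.
by rewrite half eq_sym -addr_eq0 -mulr2n pnatr_eq0.
Qed.

Lemma dyadic_rootX n i : (dyadic_root n ^+ i) ^+ (2 ^ n) = 1.
Proof. by rewrite exprAC (prim_expr_order (dyadic_root_prim n)) expr1n. Qed.

Lemma normr_root_unity n (t : C) : t ^+ (2 ^ n) = 1 -> `|t| = 1.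
Proof.
move=> /(congr1 Num.norm); rewrite normrX normr1 => /eqP.
by rewrite pexpr_eq1 ?expn_gt0 // => /eqP.
Qed.

Lemma conjc_unimodular (t : C) : `|t| = 1 -> t^*%C = t^-1.
Proof. by move=> t1; rewrite invc_norm t1 expr1n invr1 mul1r. Qed.

Lemma unimodular_neq0 (t : C) : `|t| = 1 -> t != 0.
Proof. by move=> t1; rewrite -normr_eq0 t1 oner_eq0. Qed.

Lemma unimodular_exprz (t : C) (k : int) : `|t| = 1 -> `|t ^ k| = 1.
Proof. by move=> t1; case: k => k; rewrite ?normfV normrX t1 expr1n ?invr1. Qed.

Lemma dyadic_root_exprz_eq1 n (k : int) :
  (dyadic_root n ^ k == 1) = ((2 ^ n)%N %| k)%Z.
Proof.
by case: k => k; rewrite ?invr_eq1 -(prim_order_dvd (dyadic_root_prim n)).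
Qed.

Lemma sum_dyadic_root n (k : int) :
  \sum_(i < 2 ^ n) (dyadic_root n ^+ i) ^ k =
  if ((2 ^ n)%N %| k)%Z then (2 ^ n)%:R else 0.
Proof.
pose w := dyadic_root n ^ k.
have -> : \sum_(i < 2 ^ n) (dyadic_root n ^+ i) ^ k = \sum_(i < 2 ^ n) w ^+ i.
  by apply: eq_bigr => i _; rewrite /w !exprnP !exprz_exp mulrC.
have wN : w ^+ (2 ^ n) = 1.
  by rewrite /w exprnP exprz_exp mulrC -exprz_exp -exprnP
    (prim_expr_order (dyadic_root_prim n)) exp1rz.
rewrite -dyadic_root_exprz_eq1 -/w; have [->|w1] := eqVneq w 1.
  by under eq_bigr do rewrite expr1n; rewrite sumr_const card_ord.
have := subrX1 w (2 ^ n); rewrite wN subrr => /esym/eqP.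
by rewrite mulf_eq0 subr_eq0 (negPf w1) => /eqP.
Qed.

End DyadicRoots.

Section Fejer.
Context {R : realType} {A : cstarAlgType R}.
Local Notation C := R[i]%C.
Local Notation N := (@cnorm R A).

Lemma cnorm_convex_sum (I : Type) (r : seq I) (c : I -> C) (y : I -> A) (m : R) :
  (forall i, 0 <= c i) -> \sum_(i <- r) c i = 1 -> (forall i, N (y i) <= m) ->
  N (\sum_(i <- r) c i *: y i) <= m.
Proof.
move=> c0 c1 ym; rewrite (le_trans (cnorm_sum _ _ _)) //.
have -> : m = \sum_(i <- r) complex.Re (c i) * m.
  by rewrite -mulr_suml -raddf_sum c1 /= mul1r.
apply: ler_sum => i _; rewrite cnormZ ger0_norm // ler_wpM2l //.
by have := c0 i; rewrite lecE => /andP[_].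
Qed.

(** The operators may depend on the level n: the gauge action does not, conjugation by [phase n z]
    does. [M d] collects homogeneous elements of degree d. *)
Variable alpha : nat -> C -> A -> A.
Hypothesis alpha_bop : forall n t, t ^+ (2 ^ n) = 1 -> bounded_op (alpha n t).
Hypothesis alpha_norm : forall n t x, t ^+ (2 ^ n) = 1 -> N (alpha n t x) <= N x.
Variable M : int -> set A.
Hypothesis alpha_homog : forall n t d x, t ^+ (2 ^ n) = 1 -> M d x ->
  alpha n t x = t ^ d *: x.

Local Notation z := dyadic_root.

(** A discrete Fourier coefficient: it keeps the degrees congruent to d modulo 2^n, so it isolates
    degree d only as n grows. *)
Definition component (d : int) (n : nat) (x : A) : A :=
  ((2 ^ n)%:R^-1 : C) *:
  \sum_(i < 2 ^ n) (z n ^+ i) ^ (- d) *: alpha n (z n ^+ i) x.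

Lemma pow2_neq0 n : (2 ^ n)%:R != 0 :> C.
Proof. by rewrite pnatr_eq0 expn_eq0. Qed.

Lemma component_norm d n x : N (component d n x) <= N x.
Proof.
rewrite /component cnormZVn mulrC ler_pdivrMr ?ltr0n ?expn_gt0 //.
rewrite (le_trans (cnorm_sum _ _ _)) // mulrC.
have -> : (2 ^ n)%:R * N x = \sum_(i < 2 ^ n) N x.
  by rewrite sumr_const card_ord mulr_natl.
apply: ler_sum => i _; rewrite cnormZ1 ?alpha_norm ?dyadic_rootX //.
exact/unimodular_exprz/normr_root_unity/dyadic_rootX.
Qed.

Lemma component_bop d n : bounded_op (component d n).
Proof.
apply: bop_contraction => [x y|a x|x]; last exact: component_norm.
- rewrite /component -scalerDr -big_split; congr (_ *: _); apply: eq_bigr => i _ /=.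
  by rewrite (bopD (alpha_bop (dyadic_rootX n i))) scalerDr.
- rewrite /component scalerA mulrC -scalerA; congr (_ *: _).
  rewrite scaler_sumr; apply: eq_bigr => i _ /=.
  by rewrite (bopZ (alpha_bop (dyadic_rootX n i))) !scalerA mulrC.
Qed.

Lemma component_homog d n e x : M e x ->
  component d n x = if ((2 ^ n)%N %| e - d)%Z then x else 0.
Proof.
move=> Mx; rewrite /component.
under eq_bigr => i _ do rewrite (alpha_homog (dyadic_rootX n i) Mx) scalerA
  -expfzDr ?(addrC (- d)) ?(unimodular_neq0 (normr_root_unity (dyadic_rootX n i))) //.
rewrite -scaler_suml sum_dyadic_root; case: ifP => _; last by rewrite scale0r scaler0.
by rewrite scalerA mulVf ?pow2_neq0 // scale1r.
Qed.

Lemma dvdz_small (m : nat) (k : int) : (`|k| < m)%N -> (m %| k)%Z = (k == 0).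
Proof.
move=> km; apply/idP/eqP => [|->]; last exact: dvdz0.
rewrite dvdzE /= => mk; apply/eqP; rewrite -absz_eq0; apply: contraTT mk.
by rewrite -lt0n => k0; rewrite gtnNdvd.
Qed.

Lemma component_homog_large d n e x : M e x -> (`|e - d| < 2 ^ n)%N ->
  component d n x = if e == d then x else 0.
Proof. by move=> Mx lt; rewrite (component_homog _ _ Mx) dvdz_small // subr_eq0. Qed.

Lemma ltn_exp2 n : (n < 2 ^ n)%N. Proof. exact: ltn_expl. Qed.

(** On a homogeneous element the sequence is eventually constant; contractivity extends convergence
    to the closed span. *)
Lemma component_tends d x : cspan [set y | exists e, M e y] x ->
  exists2 l, cspan (M d) l & tends (fun n => component d n x) l.
Proof.
move: x; apply: cspan_min.
  apply: clsub_tends (cspan_closed _); first exact: component_bop.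
  exact: component_norm.
move=> x [e Mx]; exists (if e == d then x else 0).
  by case: eqP => [ed|_]; [apply: cspan_sub; rewrite -ed | apply: clsub0 (cspan_closed _)].
apply: (@tends_eventually _ _ _ _ `|e - d|%N) => n en.
by rewrite (component_homog_large Mx) // (leq_ltn_trans en) // ltn_exp2.
Qed.

Lemma fixed_cspan0 x : cspan [set y | exists e, M e y] x ->
  (forall n t, t ^+ (2 ^ n) = 1 -> alpha n t x = x) -> cspan (M 0) x.
Proof.
move=> /(component_tends 0)[l Ml xl] fx; rewrite (_ : x = l) //.
apply: tends_unique xl; apply: (@tends_eventually _ _ _ _ 0) => n _.
rewrite /component; under eq_bigr do rewrite fx ?dyadic_rootX // oppr0 expr0z scale1r.
by rewrite sumr_const card_ord -[x *+ _]scaler_nat scalerA mulVf ?pow2_neq0 // scale1r.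
Qed.

(** Degree d occurs as j - k exactly D - |d| times for |d| < D, which gives the Fejer weights 1 -
    |d| / D. The double sum makes positivity of the kernel visible. *)
Definition fejer_mean (D n : nat) (x : A) : A :=
  (D%:R^-1 : C) *: \sum_(j < D) \sum_(k < D) component (j%:Z - k%:Z) n x.

(** The mean is a convex combination of the contractions [alpha n t]. *)
Lemma fejer_mean_norm D n x : (0 < D)%N -> (D <= 2 ^ n)%N ->
  N (fejer_mean D n x) <= N x.
Proof.
move=> D0 Dn; pose t (i : 'I_(2 ^ n)) : C := z n ^+ i.
have t1 i : `|t i| = 1 by apply: (normr_root_unity (dyadic_rootX n i)).
have D0' : (D%:R : C) != 0 by rewrite pnatr_eq0 -lt0n.
pose S i : C := \sum_(j < D) \sum_(k < D) t i ^ (- (j%:Z - k%:Z)).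
have -> : fejer_mean D n x =
    \sum_i ((D%:R^-1 * (2 ^ n)%:R^-1) * S i) *: alpha n (t i) x.
  rewrite /fejer_mean /component.
  under eq_bigr do rewrite -scaler_sumr exchange_big /=.
  rewrite -scaler_sumr exchange_big /= scalerA scaler_sumr; apply: eq_bigr => i _.
  under eq_bigr do rewrite -scaler_suml.
  by rewrite -scaler_suml scalerA.
apply: cnorm_convex_sum => [i||i]; last by rewrite alpha_norm ?dyadic_rootX.
  rewrite !mulr_ge0 ?invr_ge0 ?ler0n //.
  (* The kernel is the squared modulus of a geometric sum, so the weights are nonnegative. *)
  have -> : S i = (\sum_(k < D) t i ^+ k) * (\sum_(k < D) t i ^+ k)^*%C.
    rewrite rmorph_sum big_distrr; apply: eq_bigr => j _ /=.
    rewrite big_distrl; apply: eq_bigr => k _ /=.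
    rewrite rmorphXn /= conjc_unimodular // opprB expfzDr ?unimodular_neq0 //.
    by rewrite exprVn exprnN.
  exact: mulcJ_ge0.
(* As D <= 2^n, all |j - k| are below 2^n; only j = k contributes, and the weights add up to 1. *)
have sum_t (j k : 'I_D) :
    \sum_i t i ^ (- (j%:Z - k%:Z)) = if k == j then (2 ^ n)%:R else 0.
  rewrite sum_dyadic_root dvdz_small; last first.
    by have := ltn_ord j; have := ltn_ord k; lia.
  by rewrite oppr_eq0 subr_eq0 eqz_nat -val_eqE eq_sym.
rewrite -mulr_sumr /S exchange_big /=.
under eq_bigr => j _.
  rewrite exchange_big /=; under eq_bigr do rewrite sum_t.
  rewrite -big_mkcond big_pred1_eq; over.
rewrite sumr_const card_ord -[X in _ * X]mulr_natl mulrACA mulVf // mul1r.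
by rewrite mulVf ?pow2_neq0.
Qed.

Lemma fejer_mean_bop D n : bounded_op (fejer_mean D n).
Proof.
have bs (I : finType) (F : I -> A -> A) : (forall i, bounded_op (F i)) ->
    bounded_op (fun x => \sum_i F i x).
  move=> bF; split=> [x y|a x|].
  - by rewrite -big_split; apply: eq_bigr => i _; apply: bopD.
  - by rewrite scaler_sumr; apply: eq_bigr => i _; apply: bopZ.
  - have /fin_all_exists2[c c0 Fc] : forall i, exists2 C : R, 0 < C & forall x, N (F i x) <= C * N x.
      by move=> i; apply: bop_bound.
    exists (1 + \sum_i c i) => [|x]; first by rewrite ltr_wpDr // sumr_ge0 // => i _; apply: ltW.
    rewrite (le_trans (cnorm_sum _ _ _)) // mulrDl mul1r mulr_suml ler_wpDl ?cnorm_ge0 //.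
    by apply: ler_sum => i _.
apply: (@bop_comp _ _ ( *:%R (D%:R^-1 : C))); first exact: bop_scale.
by apply: (bs) => j; apply: (bs) => k; apply: component_bop.
Qed.

Lemma card_ord_lt (p D : nat) : (\sum_(j < D) (j < p : nat) <= p)%N.
Proof.
suff H : (\sum_(j < D) (j < p : nat) <= minn D p)%N by apply: leq_trans H (geq_minr _ _).
elim: D => [|D IH]; first by rewrite big_ord0.
by rewrite big_ord_recr /=; move: IH; case: (boolP (_ <= _)%N) => /=; lia.
Qed.

Lemma card_ord_ge (p D : nat) : (\sum_(j < D) (D <= j + p : nat) <= p)%N.
Proof.
suff H m : (\sum_(j < m) (D <= j + p : nat) <= m + p - D)%N by have := H D; rewrite addKn.
elim: m => [|m IH]; first by rewrite big_ord0.
by rewrite big_ord_recr /=; move: IH; case: (boolP (_ <= _)%N) => /=; lia.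
Qed.

Lemma fejer_mean_homog D n e x : M e x -> (0 < D)%N -> (D + `|e| < 2 ^ n)%N ->
  N (fejer_mean D n x - x) <= `|e|%:R / D%:R * N x.
Proof.
move=> Mx D0 Dn; have D0' : (D%:R : C) != 0 by rewrite pnatr_eq0 -lt0n.
(* The rows j for which k = j - e falls outside the range of summation; there are at most |e| of
   them, and every other row sums to x. *)
pose bad (j : 'I_D) := if 0 <= e then (j < `|e|)%N else (D <= j + `|e|)%N.
have row (j : 'I_D) : N (\sum_(k < D) component (j%:Z - k%:Z) n x - x) <= (bad j)%:R * N x.
  have -> : \sum_(k < D) component (j%:Z - k%:Z) n x =
      \sum_(k < D) if e == j%:Z - k%:Z then x else 0.
    apply: eq_bigr => k _; rewrite (component_homog_large Mx) //.
    by have := ltn_ord j; have := ltn_ord k; lia.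
  case badj: (bad j).
    rewrite big1 ?sub0r ?cnormN ?mul1r // => k _; case: eqP => // ejk; exfalso.
    move: badj; rewrite /bad; have := ltn_ord j; have := ltn_ord k; case: ifP; lia.
  have kP : (`|j%:Z - e| < D)%N.
    by move: badj; rewrite /bad; have := ltn_ord j; case: ifP; lia.
  have ke : j%:Z - e = `|j%:Z - e|%N :> int.
    by move: badj; rewrite /bad; have := ltn_ord j; case: ifP; lia.
  have eE : e == j%:Z - (`|j%:Z - e|%N)%:Z by rewrite -ke; apply/eqP; ring.
  rewrite (bigD1 (Ordinal kP)) //= eE big1 ?addr0 ?subrr ?cnorm0 ?mul0r // => k.
  by rewrite -val_eqE /= => kj; case: eqP => // ejk; exfalso; lia.
have -> : fejer_mean D n x - x =
    (D%:R^-1 : C) *: \sum_(j < D) (\sum_(k < D) component (j%:Z - k%:Z) n x - x).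
  rewrite sumrB sumr_const card_ord scalerBr -[x *+ D]scaler_nat scalerA.
  by rewrite mulVf // scale1r.
rewrite cnormZVn [_ / _]mulrC -mulrA ler_pM2l ?invr_gt0 ?ltr0n //.
rewrite (le_trans (cnorm_sum _ _ _)) // (le_trans (ler_sum _ (fun j _ => row j))) //.
rewrite -mulr_suml ler_wpM2r ?cnorm_ge0 // -natr_sum ler_nat /bad.
by case: (0 <= e); [apply: card_ord_lt | apply: card_ord_ge].
Qed.

(** D is fixed before n, since contractivity of the mean needs D <= 2^n. *)
Lemma fejer_mean_tends x : cspan [set y | exists e, M e y] x ->
  forall eps : R, 0 < eps -> exists D0, forall D, (D0 <= D)%N ->
  exists n0, forall n, (n0 <= n)%N -> N (fejer_mean D n x - x) < eps.
Proof.
move: x; apply: cspan_min; first split=> /=.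
- by move=> e e0; exists 0 => D _; exists 0 => n _; rewrite (bop0 (fejer_mean_bop _ _)) subrr cnorm0.
- move=> x y Hx Hy e e0; have e2 : 0 < e / 2 by lra.
  have [D1 H1] := Hx _ e2; have [D2 H2] := Hy _ e2.
  exists (maxn D1 D2) => D; rewrite geq_max => /andP[/H1[n1 h1] /H2[n2 h2]].
  exists (maxn n1 n2) => n; rewrite geq_max => /andP[/h1 a1 /h2 a2].
  rewrite (bopD (fejer_mean_bop _ _)) opprD addrACA (le_lt_trans (cnormD _ _)) //; lra.
- move=> a x Hx e e0; have b0 := Re_norm_ge0 a.
  have [|D0 H] := Hx (e / (complex.Re `|a| + 1)); first by rewrite divr_gt0 //; lra.
  exists D0 => D /H[n0 h]; exists n0 => n /h.
  rewrite (bopZ (fejer_mean_bop _ _)) -scalerBr cnormZ ltr_pdivlMr; last lra.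
  by have := cnorm_ge0 (fejer_mean D n x - x); nra.
- move=> x Hx e e0; have [|y Hy xy] := Hx (e / 3); first lra.
  have [|D0 H] := Hy (e / 3); first lra.
  exists D0.+1 => D DD; have [|n0 h] := H D; first exact: ltnW.
  exists (maxn n0 D) => n; rewrite geq_max => /andP[/h hn Dn].
  have := @fejer_mean_norm D n (x - y) (leq_ltn_trans (leq0n _) DD)
    (leq_trans Dn (ltnW (ltn_exp2 n))).
  rewrite (bopB _ _ (fejer_mean_bop _ _)).
  have := cnorm_dist_trans (fejer_mean D n y) (fejer_mean D n x) x.
  have := cnorm_dist_trans y (fejer_mean D n y) x.
  rewrite (cnorm_distC y); lra.
- move=> x [d Mx] e e0 /=.
  (* Chosen so that the bound |d| |x| / D on the error is below e. *)
  pose D0 := (Num.truncn (`|d|%:R * N x / e)).+1.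
  exists D0 => D DD; have Dp : (0 < D)%N by apply: leq_trans DD.
  exists (D + `|d|)%N => n dn.
  rewrite (le_lt_trans (fejer_mean_homog Mx Dp _)) //.
    by rewrite (leq_ltn_trans dn) // ltn_exp2.
  rewrite mulrAC ltr_pdivrMr ?ltr0n // -ltr_pdivrMl // mulrC.
  have : `|d|%:R * N x / e < D0%:R by rewrite truncnS_gt.
  move=> /lt_le_trans; apply; by rewrite ler_nat.
Qed.

(** The components of x stay in J and converge to homogeneous elements of J, that is, to 0. A Fejer
    mean is a finite combination of components, so it tends to 0 with n while approximating x. *)
Theorem homogeneous_vanishing (J : set A) : closed_subspace J ->
  (forall n t x, t ^+ (2 ^ n) = 1 -> J x -> J (alpha n t x)) ->
  (forall d x, J x -> cspan (M d) x -> x = 0) ->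
  forall x, J x -> cspan [set y | exists e, M e y] x -> x = 0.
Proof.
move=> cJ aJ J0 x Jx Mx.
have comp0 d : tends (fun n => component d n x) 0.
  have [l Ml xl] := component_tends d Mx; rewrite -(J0 d l) //.
  apply: tends_closed xl => // n; apply: clsubZ => //; apply: clsub_sum => // i _ _.
  by apply: clsubZ => //; apply: aJ => //; apply: dyadic_rootX.
apply: cnorm_small => e e0; have e2 : 0 < e / 2 by lra.
have [D /(_ _ (leqnn _))[n1 h1]] := fejer_mean_tends Mx e2.
have : tends (fun n => fejer_mean D n x) 0.
  have -> : 0 = (D%:R^-1 : C) *: \sum_(j < D) \sum_(k < D) (0 : A).
    by rewrite big1 ?scaler0 // => j _; rewrite big1.
  apply: (@tends_bop _ _ ( *:%R _) (fun n =>
    \sum_(j < D) \sum_(k < D) component (j%:Z - k%:Z) n x)).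
    exact: bop_scale.
  apply: (@tends_sum _ _ 'I_D (index_enum _)
    (fun j n => \sum_(k < D) component (j%:Z - k%:Z) n x) (fun=> \sum_(k < D) 0)) => j.
  exact: (@tends_sum _ _ 'I_D (index_enum _)
    (fun k n => component (j%:Z - k%:Z) n x) (fun=> 0)).
case/(_ _ e2) => n2 h2.
have := h1 _ (leq_maxl n1 n2); have := h2 _ (leq_maxr n1 n2).
move: (fejer_mean _ _ _) => y; rewrite subr0 cnorm_distC => y2 xy.
by have := cnormD (x - y) y; rewrite subrK; lra.
Qed.

End Fejer.

(** * Monomials *)

Section IntegerPowers.
Context {R : realType} {A : cstarAlgType R}.
Variable u : A.
Hypothesis hu : unitary u.

Definition upow (j : int) : A :=
  match j with Posz n => u ^+ n | Negz n => star u ^+ n.+1 end.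

Let uu : star u * u = 1. Proof. by case: hu. Qed.
Let uV : u * star u = 1. Proof. by case: hu. Qed.

Lemma upow_succ j : upow (1 + j) = u * upow j.
Proof.
case: j => [n|[|n]]; first by rewrite -PoszD add1n /= exprS.
  by rewrite /= expr1 uV.
by rewrite (_ : 1 + Negz n.+1 = Negz n) 1?[RHS]/= 1?exprS 1?mulrA ?uV ?mul1r //; lia.
Qed.

Lemma upow_pred j : upow (- 1 + j) = star u * upow j.
Proof.
by have := upow_succ (-1 + j); rewrite addrA subrr add0r => ->; rewrite mulrA uu mul1r.
Qed.

Lemma upowD i j : upow (i + j) = upow i * upow j.
Proof.
elim/int_ind: i => [|n IH|n IH]; first by rewrite add0r mul1r.
- by rewrite (_ : n.+1%:Z = 1 + n) ?intS // -addrA !upow_succ IH mulrA.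
- by rewrite (_ : - n.+1%:Z = -1 + - n%:Z) ?intS ?opprD // -addrA !upow_pred IH mulrA.
Qed.

Lemma upow1 : upow 1 = u. Proof. by rewrite /= expr1. Qed.

Lemma upowN1 : upow (-1) = star u. Proof. by rewrite /= expr1. Qed.

Lemma star_upow j : star (upow j) = upow (- j).
Proof. by case: j => [[|n]|n]; rewrite /= ?expr0 ?star1 // starX ?starK. Qed.

Lemma upowNK j : upow (- j) * upow j = 1.
Proof. by rewrite -upowD addNr. Qed.

Lemma upowKN j : upow j * upow (- j) = 1.
Proof. by rewrite -upowD subrr. Qed.

Lemma upow_norm j : cnorm (upow j) = 1.
Proof. by apply: cnorm_isometry; rewrite /Defs.isometry star_upow upowNK. Qed.

End IntegerPowers.

Section Monomials.
Context {R : realType} {A : cstarAlgType R}.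
Local Notation C := R[i]%C.
Local Notation N := (@cnorm R A).
Variables u s : A.
Hypothesis rel : Q2_relations u s.
Local Notation t := (star s).
Local Notation p2 m := ((2 ^ m)%N%:Z).
Local Notation upow := (upow u).

Let hu : unitary u. Proof. by case: rel. Qed.
Let uu : star u * u = 1. Proof. by case: hu. Qed.
Let uV : u * star u = 1. Proof. by case: hu. Qed.
Let ts : t * s = 1. Proof. by case: rel. Qed.
Let uS := upow_succ hu.
Let uP := upow_pred hu.
Let uD := upowD hu.

Let starsX_sX m : t ^+ m * s ^+ m = 1.
Proof. exact: starX_mulX. Qed.

Lemma s_upow j : s * upow j = upow (2 * j) * s.
Proof.
have su : s * u = u * (u * s) by case: rel => _ _; rewrite mulrA expr2.
have suV : s * star u = star u * (star u * s).
  rewrite -[in RHS](mulr1 s) -uV (mulrA s) su -!mulrA (mulrA _ u) uu mul1r.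
  by rewrite mulrA uu mul1r.
elim/int_ind: j => [|n IH|n IH]; first by rewrite mulr0 mulr1 mul1r.
- rewrite (_ : 2 * n.+1%:Z = 1 + (1 + 2 * n%:Z)); last by rewrite intS; ring.
  by rewrite intS !uS mulrA su -!mulrA IH.
- rewrite (_ : 2 * (- n.+1%:Z) = -1 + (-1 + 2 * (- n%:Z))); last by rewrite intS; ring.
  by rewrite intS opprD !uP mulrA suV -!mulrA IH.
Qed.

Lemma sX_upow m j : s ^+ m * upow j = upow (p2 m * j) * s ^+ m.
Proof.
elim: m j => [|m IH] j; first by rewrite mul1r mul1r mulr1.
by rewrite exprSr -mulrA s_upow mulrA IH -mulrA -exprSr expnSr PoszM mulrA.
Qed.

Lemma upow_starsX m j : upow j * t ^+ m = t ^+ m * upow (p2 m * j).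
Proof.
have := congr1 star (sX_upow m (- j)).
by rewrite !starM !star_upow starX mulrN !opprK.
Qed.

(** With y = s^* u s, compressing the range sum relation by s yields 1 + y y^* = 1. *)
Lemma stars_u_s : t * u * s = 0.
Proof.
have [_ _ _ sum] := rel.
have : t * (s * t + u * s * t * star u) * s = t * s by rewrite sum mulr1.
rewrite mulrDr mulrDl !mulrA ts mul1r ts -[RHS]addr0 => /addrI h.
rewrite -[LHS]starK (star_mul_eq0 (x := star (t * u * s))) ?star0 //.
by rewrite starK !starM starK -[RHS]h !mulrA.
Qed.

Lemma compress_dvd m k : t ^+ m * upow (p2 m * k) * s ^+ m = upow k.
Proof. by rewrite -mulrA -sX_upow mulrA starsX_sX mul1r. Qed.

Lemma int_parity (j : int) : exists k : int, j = 2 * k \/ j = 1 + 2 * k.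
Proof. by exists (j %/ 2)%Z; lia. Qed.

(** Each compression by s halves an even exponent; the first odd exponent gives 0 by [stars_u_s]. *)
Lemma compress_ndvd m j : ~~ (p2 m %| j)%Z -> t ^+ m * upow j * s ^+ m = 0.
Proof.
elim: m j => [|m IH] j; first by rewrite dvd1z.
have [k [->|->]] := int_parity j => nd.
- rewrite exprSr exprS !mulrA -(mulrA (_ ^+ m)) -(mulrA (t ^+ m)).
  rewrite (_ : t * _ * s = upow k) ?IH //; last by have := compress_dvd 1 k; rewrite !expr1.
  by apply: contra nd; rewrite expnS PoszM dvdz_mul2l.
- rewrite exprSr exprS uS !mulrA -(mulrA _ _ s) -s_upow !mulrA.
  by rewrite -(mulrA _ t u) -(mulrA _ (t * u) s) stars_u_s mulr0 !mul0r.
Qed.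

(** The sign of b is chosen so that the adjoint exchanges the pairs (a, m) and (b, n). *)
Definition mono (a : int) (m n : nat) (b : int) : A :=
  upow a * s ^+ m * t ^+ n * upow (- b).

(** The range projection of u^j s^m; it depends on j modulo 2^m only. *)
Definition qproj (m : nat) (j : int) : A := mono j m m j.

Lemma star_mono a m n b : star (mono a m n b) = mono b n m a.
Proof. by rewrite /mono !starM !star_upow !starX starK opprK !mulrA. Qed.

Lemma upow_mono j a m n b : upow j * mono a m n b = mono (j + a) m n b.
Proof. by rewrite /mono !mulrA -uD. Qed.

Lemma s_mono a m n b : s * mono a m n b = mono (2 * a) m.+1 n b.
Proof. by rewrite /mono !mulrA s_upow -(mulrA _ s) -exprS. Qed.

Lemma stars_mono0 a n b : t * mono a 0 n b = mono 0 0 n.+1 (b - p2 n * a).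
Proof.
rewrite /mono mulr1 upow_starsX mulr1 mul1r -[t ^+ n * _ * _]mulrA -uD mulrA.
by rewrite -exprS opprB addrC.
Qed.

Lemma stars_mono_even k m n b : t * mono (2 * k) m.+1 n b = mono k m n b.
Proof. by rewrite -s_mono mulrA ts mul1r. Qed.

Lemma stars_mono_odd k m n b : t * mono (1 + 2 * k) m.+1 n b = 0.
Proof. by rewrite -upow_mono upow1 -s_mono !mulrA stars_u_s !mul0r. Qed.

(** The range sum relation is inserted between the powers of s and of its adjoint. *)
Lemma mono_succ a m n b :
  mono a m n b = mono a m.+1 n.+1 b + mono (a + p2 m) m.+1 n.+1 (b + p2 n).
Proof.
have [_ _ _ sum] := rel.
rewrite {1}/mono -[upow a * s ^+ m]mulr1 -sum mulrDr !mulrDl; congr (_ + _).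
  by rewrite /mono exprSr exprS !mulrA.
rewrite /mono uD opprD [- b + _]addrC uD exprSr exprS.
rewrite -(mulrA (upow a) _ (_ * s)) (mulrA _ (s ^+ m) s) -{1}(mulr1 (p2 m)) -sX_upow upow1.
have := upow_starsX n (-1); rewrite mulrN mulr1 upowN1 => tn.
by rewrite -!mulrA; do 5! congr (_ * _); rewrite !mulrA tn.
Qed.

(** Used to bring monomials to a common or sufficiently high level; a - b is preserved in every term
    when m = n. *)
Lemma mono_raise k a m n b :
  mono a m n b = \sum_(0 <= r < 2 ^ k)
    mono (a + p2 m * r%:Z) (m + k) (n + k) (b + p2 n * r%:Z).
Proof.
elim: k => [|k IH]; first by rewrite big_nat1 !mulr0 !addr0 !addn0.
rewrite IH expnS mul2n -addnn [RHS](big_cat_nat _ (n := 2 ^ k)) ?leq_addr //=.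
rewrite -[X in _ = _ + \sum_(X <= _ < _) _]add0n big_addn addnK -big_split; apply: eq_bigr => r _ /=.
rewrite mono_succ !addnS; congr (_ + mono _ _ _ _).
- by rewrite expnD PoszM PoszD; ring.
- by rewrite expnD PoszM PoszD; ring.
Qed.

Lemma sum_qproj m : \sum_(j < 2 ^ m) qproj m j = 1.
Proof.
rewrite -(big_mkord xpredT (fun j : nat => qproj m j)).
have := mono_raise m 0 0 0 0; rewrite {1}/mono !mulr1 => h; rewrite -[RHS]/(upow 0) h.
by apply: eq_bigr => r _; rewrite /qproj !add0n add0r mul1r.
Qed.

Lemma qproj_mul m n i j : (m <= n)%N ->
  qproj m j * (upow i * s ^+ n) = if (p2 m %| i - j)%Z then upow i * s ^+ n else 0.
Proof.
move=> /subnKC <-; rewrite exprD /qproj /mono.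
have -> : upow j * s ^+ m * t ^+ m * upow (- j) * (upow i * (s ^+ m * s ^+ (n - m))) =
   upow j * s ^+ m * (t ^+ m * upow (i - j) * s ^+ m) * s ^+ (n - m).
  by rewrite addrC uD !mulrA.
case: ifP => [/dvdzP[k ijk]|/negbT nd]; last by rewrite compress_ndvd // mulr0 mul0r.
rewrite ijk mulrC compress_dvd -(mulrA _ (s ^+ m)) sX_upow -!mulrA mulrA -uD.
by rewrite mulrC -ijk addrC subrK mulrA.
Qed.

Lemma qproj_mul_mono m n i j k b : (m <= n)%N ->
  qproj m j * mono i n k b = if (p2 m %| i - j)%Z then mono i n k b else 0.
Proof.
move=> mn; rewrite {1}/mono !mulrA -(mulrA (qproj m j)) qproj_mul //.
by case: ifP => _; rewrite ?mul0r.
Qed.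

Lemma mono_mul m a b c d :
  mono a m m b * mono c m m d =
  if (p2 m %| c - b)%Z then mono (a + (c - b)) m m d else 0.
Proof.
have -> : mono a m m b * mono c m m d =
   upow a * s ^+ m * (t ^+ m * upow (c - b) * s ^+ m) * t ^+ m * upow (- d).
  by rewrite /mono addrC uD !mulrA.
case: ifP => [/dvdzP[k ijk]|/negbT nd]; last by rewrite compress_ndvd // mulr0 !mul0r.
rewrite ijk mulrC compress_dvd -(mulrA _ (s ^+ m)) sX_upow mulrA -uD.
by rewrite mulrC -ijk.
Qed.

Lemma star_qproj m j : star (qproj m j) = qproj m j.
Proof. exact: star_mono. Qed.

Lemma dvdz_sub_ord m (i j : 'I_(2 ^ m)) : (p2 m %| i%:Z - j%:Z)%Z = (i == j).
Proof.
rewrite dvdz_small ?subr_eq0 ?eqz_nat //.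
by have := ltn_ord i; have := ltn_ord j; lia.
Qed.

Lemma qproj_orth m (i j : 'I_(2 ^ m)) :
  qproj m i * qproj m j = if i == j then qproj m i else 0.
Proof.
by rewrite qproj_mul_mono // dvdz_sub_ord eq_sym; case: eqP => [->|].
Qed.

(** * Diagonal elements of a fixed level and their norm *)

Definition diag (n : nat) (c : nat -> C) : A := \sum_(j < 2 ^ n) c j *: qproj n j.

Lemma star_diag n c : star (diag n c) = diag n (fun j => (c j)^*%C).
Proof. by rewrite star_sum; apply: eq_bigr => j _; rewrite starZ star_qproj. Qed.

Lemma diag_mul n c d : diag n c * diag n d = diag n (fun j => c j * d j).
Proof.
rewrite /diag mulr_suml; apply: eq_bigr => i _; rewrite mulr_sumr (bigD1 i) //= big1.
  by rewrite addr0 -scalerAl -scalerAr scalerA qproj_orth eqxx.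
by move=> j ji; rewrite -scalerAl -scalerAr qproj_orth eq_sym (negPf ji) !scaler0.
Qed.

Lemma diag_unitary n c : (forall j, `|c j| = 1) -> unitary (diag n c).
Proof.
move=> c1; have one d : (forall j, d j = 1) -> diag n d = 1.
  by move=> d1; rewrite -(sum_qproj n); apply: eq_bigr => j _; rewrite d1 scale1r.
split; rewrite star_diag diag_mul one // => j; first rewrite mulrC;
by rewrite -sqr_normc c1 expr1n.
Qed.

(** Writing c = r v with v on the circle, c is the midpoint of the chord with ends v (r + i y) and v
    (r - i y), where r^2 + y^2 = 1. *)
Lemma unimodular_average (c : C) : `|c| <= 1 ->
  exists p : C * C, [/\ `|p.1| = 1, `|p.2| = 1 & c = 2^-1 * (p.1 + p.2)].
Proof.
have [->|c0] := eqVneq c 0 => c1.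
  by exists (1, -1); split; rewrite /= ?normrN ?normr1 ?subrr ?mulr0.
pose v := c / `|c|; have cn : `|c| != 0 by rewrite normr_eq0.
have vn : `|v| = 1 by rewrite normrM normfV normr_id mulfV.
have r0 : 0 <= `|c| by []; have rr := ger0_real r0.
set r := `|c| in c1 cn r0 rr v vn *.
have d0 : 0 <= 1 - r ^+ 2 by rewrite subr_ge0 expr_le1.
pose y := sqrtC (1 - r ^+ 2); have y0 : 0 <= y by rewrite sqrtC_ge0.
have yr := ger0_real y0; have y2 : y ^+ 2 = 1 - r ^+ 2 by rewrite sqrtCK.
have n1 (e : C) : e = y \/ e = - y -> `|v * (r + 'i * e)| = 1.
  move=> ee; have er : e \is Num.real by case: ee => ->; rewrite ?rpredN.
  have e2 : e ^+ 2 = y ^+ 2 by case: ee => ->; rewrite ?sqrrN.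
  rewrite normrM vn mul1r; apply/eqP.
  by rewrite -(@pexpr_eq1 _ _ 2) ?normr_ge0 // normC2_rect // e2 y2 addrC subrK.
exists (v * (r + 'i * y), v * (r + 'i * - y)); split=> /=.
- by apply: n1; left.
- by apply: n1; right.
rewrite -mulrDr mulrN addrACA subrr addr0 -mulr2n -[r *+ 2]mulr_natl mulrCA.
by rewrite mulKf ?pnatr_eq0 // /v mulfVK.
Qed.

(* [diag n c] is a multiple of the mean of two unitaries of the same form. *)
Lemma diag_norm n c (e : R) : 0 < e ->
  (forall j : nat, (j < 2 ^ n)%N -> complex.Re `|c j| <= e) -> N (diag n c) <= e.
Proof.
move=> e0 ce.
(* The coefficients are cut off beyond 2^n, where nothing bounds them, so that the decomposition can
   be chosen for all j at once. *)
pose c' j : C := if (j < 2 ^ n)%N then (e^-1)%:C%C * c j else 0.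
have c'1 j : `|c' j| <= 1.
  rewrite /c'; case: ifP => [/ce cj|]; last by rewrite normr0.
  have eE : `|(e^-1)%:C%C : C| = (e^-1)%:C%C.
    by rewrite ger0_norm // lecR invr_ge0 ltW.
  rewrite normrM eE; have : `|c j| = (complex.Re `|c j|)%:C%C.
    by rewrite normc_def.
  move=> ->; rewrite -rmorphM /= (_ : 1 = (1 : R)%:C%C) // lecR mulrC ler_pdivrMr //.
  by rewrite mul1r.
have /choice[p pP] := fun j => unimodular_average (c'1 j).
have -> : diag n c = e%:C%C *: ((2%:R^-1 : C) *: (diag n (fun j => (p j).1) +
                                diag n (fun j => (p j).2))).
  rewrite /diag -big_split /= !scaler_sumr; apply: eq_bigr => j _.
  rewrite -scalerDl !scalerA; congr (_ *: _).
  have [_ _ cE] := pP j; rewrite -mulrA -cE /c' ltn_ord mulrA -rmorphM /= mulfV ?mul1r //.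
  by rewrite gt_eqF.
rewrite cnormZ normc_def /= expr0n addr0 sqrtr_sqr gtr0_norm // cnormZVn.
rewrite ler_piMr ?(ltW e0) // mulrC ler_pdivrMr // mul1r (le_trans (cnormD _ _)) //.
rewrite !cnorm_unitary; first by lra.
- by apply: diag_unitary => j; case: (pP j).
- by apply: diag_unitary => j; case: (pP j).
Qed.

End Monomials.

(** * Gradings *)

Section Gradings.
Context {R : realType} {Q : cstarAlgType R}.
Local Notation C := R[i]%C.
Local Notation N := (@cnorm R Q).
Variables u s : Q.
Hypothesis hQ : is_Q2 u s.
Local Notation t := (star s).
Local Notation p2 m := ((2 ^ m)%N%:Z).
Let rel : Q2_relations u s := Q2_rel hQ.
Let hu : unitary u := Q2_unitary rel.
Local Notation upow := (upow u).
Local Notation mono := (mono u s).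
Local Notation qproj := (qproj u s).
Local Notation diag := (diag u s).

Definition gauge_degree (d : int) : set Q :=
  [set x | exists a m n b, m%:Z - n%:Z = d /\ x = mono a m n b].

Definition diag_degree (k : int) : set Q :=
  [set x | exists m a b, a - b = k /\ x = mono a m m b].

Lemma setT_subalgebra : cstar_subalgebra [set: Q].
Proof. by split. Qed.

Lemma mono0000 : mono 0 0 0 0 = 1.
Proof. by rewrite /mono /= !mulr1. Qed.

(** The elements x such that x and x^* multiply the span into itself from the left form a
    C^*-algebra containing u and s, hence everything; they are applied to 1, which is a monomial. *)
Lemma cspan_gauge_degree : cspan [set x | exists d, gauge_degree d x] = setT.
Proof.
set T := cspan _; have cT : closed_subspace T := cspan_closed _.
have monoT a m n b : T (mono a m n b).
  by apply: cspan_sub; exists (m%:Z - n%:Z), a, m, n, b.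
have mapT z : (forall a m n b, T (z * mono a m n b)) -> forall y, T y -> T (z * y).
  move=> zM; apply: (cspan_map (bop_mull z) cT) => _ [d [a [m [n [b [_ ->]]]]]].
  exact: zM.
pose S := [set x : Q | (forall y, T y -> T (x * y)) /\ (forall y, T y -> T (star x * y))].
have sS : cstar_subalgebra S.
  split.
  - by split=> y Ty; rewrite ?star0 mul0r; apply: clsub0.
  - by move=> x y [x1 x2] [y1 y2]; split=> z Tz; rewrite ?starD mulrDl; apply: (clsubD cT); auto.
  - by move=> a x [x1 x2]; split=> z Tz; rewrite ?starZ -scalerAl; apply: (clsubZ cT); auto.
  - by move=> x y [x1 x2] [y1 y2]; split=> z Tz; rewrite ?starM -mulrA; auto.
  - by move=> x [x1 x2]; split=> z Tz; rewrite ?starK; auto.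
  - move=> x Hx; split=> z Tz.
    + apply: (clsub_closed (clsub_preim (bop_mulr z) cT)) => e /Hx[y [Sy _] xy].
      by exists y => //; apply: Sy.
    + apply: (clsub_closed (clsub_preim (bop_mulr z) cT)) => e /Hx[y [_ Sy] xy].
      by exists (star y); [apply: Sy | rewrite -starB cnorm_star].
have Su : S u.
  split; apply: mapT => a m n b.
    by have := upow_mono rel 1 a m n b; rewrite upow1 => ->.
  by have := upow_mono rel (-1) a m n b; rewrite upowN1 => ->.
have Ss : S s.
  split; apply: mapT => a m n b; first by rewrite s_mono.
  case: m => [|m]; first by rewrite stars_mono0.
  have [k [->|->]] := int_parity a; first by rewrite stars_mono_even.
  by rewrite stars_mono_odd //; apply: clsub0.
have ST x : S x.
  have : cstar_gen [set u; s] x by rewrite (Q2_gen hQ).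
  by apply; split=> // y [->|->].
apply/seteqP; split=> // x _; rewrite -[x]mulr1; apply: (ST x).1.
by rewrite -mono0000.
Qed.

Lemma hom_upow (f : Q -> Q) j : star_hom_on setT f -> f u = u -> f (upow j) = upow j.
Proof.
move=> hf fu; have fX x n : f (x ^+ n) = f x ^+ n.
  by elim: n => [|n IH]; [rewrite !expr0 (star_hom1 hf) | rewrite !exprS (star_homM hf) // IH].
by case: j => n; rewrite /= fX ?(star_hom_star hf) // fu.
Qed.

Lemma gauge_hom (z : C) : `|z| = 1 -> star_hom_on setT (gauge u s z).
Proof. by move=> /(gaugeP hQ)[[]]. Qed.

Lemma gauge_bop (z : C) : `|z| = 1 -> bounded_op (gauge u s z).
Proof.
move=> z1; have hf := gauge_hom z1; apply: bop_contraction => [x y|a x|x].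
- exact: (star_homD hf).
- exact: (star_homZ hf).
- exact: (star_hom_contraction setT_subalgebra _ hf).
Qed.

Lemma gauge_norm (z : C) x : `|z| = 1 -> N (gauge u s z x) <= N x.
Proof. by move=> /gauge_hom hf; apply: (star_hom_contraction setT_subalgebra _ hf). Qed.

Lemma gauge_mono (z : C) a m n b : `|z| = 1 ->
  gauge u s z (mono a m n b) = z ^ (m%:Z - n%:Z) *: mono a m n b.
Proof.
move=> z1; have hf := gauge_hom z1; have [_ _ fu fs] := gaugeP hQ z1.
have fM x y : gauge u s z (x * y) = gauge u s z x * gauge u s z y by apply: (star_homM hf).
have fX x k : gauge u s z (x ^+ k) = gauge u s z x ^+ k.
  by elim: k => [|k IH]; [rewrite !expr0 (star_hom1 hf) | rewrite !exprS fM IH].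
rewrite {1}/mono !fM !(hom_upow _ hf fu) !fX (star_hom_star hf) // fs starZ.
rewrite !exprZn conjc_unimodular // -!(scalerAl, scalerAr) scalerA.
by rewrite /mono; congr (_ *: _); rewrite expfzDr ?unimodular_neq0 // exprVn exprnN mulrC.
Qed.

Lemma gauge_homog n (z : C) d x : z ^+ (2 ^ n) = 1 -> gauge_degree d x ->
  gauge u s z x = z ^ d *: x.
Proof.
by move=> /normr_root_unity z1 [a [m [k [b [<- ->]]]]]; rewrite gauge_mono.
Qed.

(* The Bunce-Deddens algebra, the fixed points of the gauge action. *)
Definition core : set Q := cspan (gauge_degree 0).

(** An element fixed by the dyadic roots of unity equals all its degree zero averages, hence their
    limit. *)
Lemma coreP x : core x <-> forall n (z : C), z ^+ (2 ^ n) = 1 -> gauge u s z x = x.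
Proof.
split=> [Bx n z z1|fx].
  move: x Bx; apply: cspan_min.
    by apply: (clsub_eq _ bop_id); apply: gauge_bop; apply: normr_root_unity z1.
  by move=> x hx /=; rewrite (gauge_homog z1 hx) expr0z scale1r.
apply: (@fixed_cspan0 _ _ (fun=> gauge u s)) => // [n z z1|n z y z1|n z d y|].
- exact/gauge_bop/(normr_root_unity z1).
- exact/gauge_norm/(normr_root_unity z1).
- exact: gauge_homog.
- by rewrite cspan_gauge_degree.
Qed.

Lemma core_subalgebra : cstar_subalgebra core.
Proof.
have cB : closed_subspace core := cspan_closed _.
split; try by case: cB.
- move=> x y /coreP Bx /coreP By; apply/coreP => n z z1.
  by rewrite (star_homM (gauge_hom (normr_root_unity z1))) // (Bx n) // (By n).
- move=> x /coreP Bx; apply/coreP => n z z1.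
  by rewrite (star_hom_star (gauge_hom (normr_root_unity z1))) // (Bx n).
Qed.

Lemma coreM x y : core x -> core y -> core (x * y).
Proof. by have [_ _ _ h _ _] := core_subalgebra; apply: h. Qed.

Lemma core_mono a m b : core (mono a m m b).
Proof. by apply: cspan_sub; exists a, m, m, b; rewrite subrr. Qed.

Lemma core_upow j : core (upow j).
Proof.
by have := core_mono j 0 0; rewrite /mono /= !mulr1.
Qed.

Lemma core_F2 : F2 u s `<=` core.
Proof. by move=> x [_ fx]; apply/coreP => n z /normr_root_unity /fx. Qed.

Lemma gauge_degree0E : gauge_degree 0 = [set x | exists k, diag_degree k x].
Proof.
apply/seteqP; split=> x /=.
- move=> [a [m [n [b [/eqP mn ->]]]]]; exists (a - b), m, a, b; split=> //.
  by move: mn; rewrite subr_eq0 eqz_nat => /eqP ->.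
- by move=> [k [m [a [b [_ ->]]]]]; exists a, m, m, b; rewrite subrr.
Qed.

(* Conjugation by [phase n z], for [z] a [2 ^ n]-th root of unity, sends [u] to
   [z u] and fixes the diagonal: the dual action of the dyadic roots of unity on
   [core] is inner. *)
Definition phase (n : nat) (z : C) : Q := diag n (fun j => z ^+ j).

Lemma phase_unitary n (z : C) : `|z| = 1 -> unitary (phase n z).
Proof. by move=> z1; apply: diag_unitary => // j; rewrite normrX z1 expr1n. Qed.

Lemma core_phase n z : core (phase n z).
Proof.
apply: clsub_sum (cspan_closed _) _ => j _ _; apply: (clsubZ (cspan_closed _)).
exact: core_mono.
Qed.

(** For m >= n the range of u^i s^m lies under [qproj n r] with r = i mod 2^n, where the phase acts
    as z^r = z^i. *)
Lemma phase_mul n m z i : (n <= m)%N -> z ^+ (2 ^ n) = 1 ->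
  phase n z * (upow i * s ^+ m) = z ^ i *: (upow i * s ^+ m).
Proof.
move=> nm z1; have zn0 := unimodular_neq0 (normr_root_unity z1).
have p0 : p2 n != 0 by rewrite eqz_nat expn_eq0.
have rlt : (`|(i %% p2 n)%Z| < 2 ^ n)%N.
  have := ltz_pmod i (_ : 0 < p2 n); have := modz_ge0 i p0.
  rewrite ltz_nat expn_gt0 => ? /(_ isT); lia.
pose q := (i %/ p2 n)%Z; pose r := Ordinal rlt.
have rE : i = p2 n * q + r%:Z.
  by rewrite {1}(divz_eq i (p2 n)) mulrC /= gez0_abs // modz_ge0.
have rdvd : (p2 n %| i - r%:Z)%Z by rewrite {1}rE addrK dvdz_mulr.
have zi : z ^ i = z ^+ r.
  by rewrite {1}rE expfzDr // -exprz_exp -exprnP z1 exp1rz mul1r.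
rewrite /phase mulr_suml (bigD1 r) //= big1 ?addr0 => [|j jr].
  by rewrite -scalerAl qproj_mul // rdvd zi.
rewrite -scalerAl qproj_mul //.
have -> : i - j%:Z = (i - r%:Z) + (r%:Z - j%:Z) by rewrite addrA subrK.
rewrite rpredDl ?dvdz_sub_ord //.
by rewrite eq_sym (negPf jr) scaler0.
Qed.

Definition phase_conj (n : nat) (z : C) (x : Q) : Q := phase n z * x * star (phase n z).

Lemma phase_conj_bop n z : bounded_op (phase_conj n z).
Proof. exact: bop_comp (bop_mulr _) (bop_mull _). Qed.

Lemma phase_conj_norm n z x : z ^+ (2 ^ n) = 1 -> N (phase_conj n z x) <= N x.
Proof.
move=> /normr_root_unity/(phase_unitary n)/cnorm_unitary w1.
by rewrite (le_trans (cnorm_mulr_le _ _)) ?cnorm_star ?w1 // cnorm_mull_le ?w1.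
Qed.

Lemma phase_conj_diagonal n z d x : z ^+ (2 ^ n) = 1 -> diag_degree d x ->
  phase_conj n z x = z ^ d *: x.
Proof.
move=> z1 [m [a [b [<- ->]]]]; have zn := normr_root_unity z1.
have large k a' b' : (n <= k)%N ->
    phase_conj n z (mono a' k k b') = z ^ (a' - b') *: mono a' k k b'.
  move=> nk; have -> : mono a' k k b' = (upow a' * s ^+ k) * star (upow b' * s ^+ k).
    by rewrite starM star_upow starX /mono !mulrA.
  rewrite /phase_conj mulrA -(mulrA _ _ (star _)) -starM !phase_mul // starZ.
  rewrite -scalerAl -scalerAr scalerA; congr (_ *: _).
  rewrite conjc_unimodular ?unimodular_exprz // expfzDr ?unimodular_neq0 //.
  by rewrite invr_expz mulrC.
(* Raising the level by n makes [phase_mul] available on both sides of each monomial. *)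
rewrite (mono_raise rel n) (bop_sum _ _ _ (phase_conj_bop n z)) scaler_sumr.
apply: eq_bigr => r _; rewrite large ?leq_addl //; congr (_ ^ _ *: _); ring.
Qed.

(** * The diagonal subalgebra as the closed span of the range projections *)

Lemma diag_degree0_subalgebra : cstar_subalgebra (cspan (diag_degree 0)).
Proof.
have c0 : closed_subspace (cspan (diag_degree 0)) := cspan_closed _.
have q0 m a : diag_degree 0 (qproj m a) by exists m, a, a; rewrite subrr.
have mulq m n a b : (m <= n)%N -> cspan (diag_degree 0) (qproj m a * qproj n b).
  move=> mn; rewrite qproj_mul_mono //; case: ifP => _; last exact: clsub0 c0.
  by apply: cspan_sub; apply: q0.
have q0E x : diag_degree 0 x -> exists m a, x = qproj m a.
  by move=> [m [a [b [/subr0_eq -> ->]]]]; exists m, b.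
apply: cspan_subalgebra => [x /q0E[m [a ->]]|x y /q0E[m [a ->]] /q0E[n [b ->]]].
  by rewrite star_qproj; apply: q0.
have [mn|/ltnW nm] := leqP m n; first exact: mulq.
rewrite -[_ * _]starK starM !star_qproj qproj_mul_mono //; case: ifP => _.
  by rewrite star_qproj; apply: cspan_sub; apply: q0.
by rewrite star0; apply: clsub0 c0.
Qed.

(** The lowest m binary digits of j spell the word; the remaining quotient is the power of u on the
    right, which cancels in range projections. *)
Lemma upow_sX_word m j : exists (mu : seq bool) (k : int),
  upow j * s ^+ m = s_word u s mu * upow k.
Proof.
elim: m j => [|m IH] j; first by exists [::], j; rewrite /s_word big_nil mulr1 mul1r.
have [k jk] := int_parity j; have [mu [l e]] := IH k.
have [b ->] : exists b, upow j * s ^+ m.+1 = s_ u s b * (upow k * s ^+ m).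
  case: jk => ->.
    by exists false; rewrite /= mulrA s_upow // exprS mulrA.
  by exists true; rewrite /= upow_succ // exprS !mulrA -(mulrA u _ s) -s_upow // !mulrA.
by exists (b :: mu), l; rewrite e /s_word big_cons mulrA.
Qed.

Lemma s_wordE mu : exists a, s_word u s mu = upow a * s ^+ size mu.
Proof.
elim: mu => [|b mu [a e]]; first by exists 0; rewrite /s_word big_nil mulr1.
exists (b%:Z + 2 * a); rewrite /s_word big_cons -/(s_word u s mu) e upowD //.
rewrite exprS !mulrA -(mulrA _ _ s) -s_upow //.
by case: b; rewrite /= ?expr1 ?expr0 ?mul1r ?mulrA.
Qed.

Lemma D2_eq : D2 u s = cspan (diag_degree 0).
Proof.
apply/seteqP; split.
- move=> x; apply; split; first exact: diag_degree0_subalgebra.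
  move=> _ [mu _ <-]; have [a ->] := s_wordE mu; apply: cspan_sub.
  exists (size mu), a, a; rewrite subrr; split=> //.
  by rewrite starM starX star_upow !mulrA.
- have sD : cstar_subalgebra (D2 u s) by apply: cstar_gen_subalgebra.
  apply: cspan_min; first exact: cstar_subalgebra_closed.
  move=> _ [m [a [b [/subr0_eq -> ->]]]].
  have [mu [k e]] := upow_sX_word m b => S [_]; apply; exists mu => //.
  have -> : mono b m m b = upow b * s ^+ m * star (upow b * s ^+ m).
    by rewrite starM starX star_upow !mulrA.
  by rewrite e starM star_upow mulrA -(mulrA _ (upow k)) upowKN // mulr1.
Qed.

(** The approximant is a combination of projections of level at most m, each of which contains or is
    orthogonal to any given [qproj n j] with n >= m. *)
Lemma diag_degree0_approx x : cspan (diag_degree 0) x -> forall e : R, 0 < e ->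
  exists m y, N (x - y) < e /\ forall n j, (m <= n)%N ->
    exists c : C, y * qproj n j = c *: qproj n j.
Proof.
move: x; apply: cspan_min; first split=> /=.
- by move=> e e0; exists 0, 0; rewrite subrr cnorm0; split=> // n j _; exists 0; rewrite mul0r scale0r.
- move=> x y Hx Hy e e0; have e2 : 0 < e / 2 by lra.
  have [m1 [x' [xx' h1]]] := Hx _ e2; have [m2 [y' [yy' h2]]] := Hy _ e2.
  exists (maxn m1 m2), (x' + y'); split.
    rewrite opprD addrACA (le_lt_trans (cnormD _ _)) //; lra.
  move=> n j; rewrite geq_max => /andP[/(h1 n j)[c cE] /(h2 n j)[d dE]].
  by exists (c + d); rewrite mulrDl cE dE scalerDl.
- move=> a x Hx e e0; have b0 := Re_norm_ge0 a.
  have [|m [y [xy h]]] := Hx (e / (complex.Re `|a| + 1)); first by rewrite divr_gt0 //; lra.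
  exists m, (a *: y); split.
    move: xy; rewrite -scalerBr cnormZ ltr_pdivlMr; last lra.
    by have := cnorm_ge0 (x - y); nra.
  move=> n j /(h n j)[c cE]; exists (a * c).
  by rewrite -scalerAl cE scalerA.
- move=> x Hx e e0; have [|y Hy xy] := Hx (e / 2); first lra.
  have [|m [y' [yy' h]]] := Hy (e / 2); first lra.
  exists m, y'; split=> //; have := cnorm_dist_trans y x y'; lra.
- move=> _ [m [a [b [/subr0_eq -> ->]]]] e e0 /=.
  exists m, (mono b m m b); rewrite subrr cnorm0; split=> // n j mn.
  rewrite (qproj_mul_mono rel) //; case: ifP => _; first by exists 1; rewrite scale1r.
  by exists 0; rewrite scale0r.
Qed.

(** Induction on the degree: s^* and s^* u^* lower a positive degree, and an element killed by both
    is 0 by the range sum relation; the isometry s raises a negative degree. *)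
Lemma gauge_vanishing (J : set Q) : closed_subspace J ->
  (forall x y, J y -> J (x * y)) ->
  (forall n (z : C) x, z ^+ (2 ^ n) = 1 -> J x -> J (gauge u s z x)) ->
  (forall x, J x -> core x -> x = 0) -> forall x, J x -> x = 0.
Proof.
move=> cJ lJ gJ J0 x Jx.
apply: (@homogeneous_vanishing _ _ (fun=> gauge u s) _ _ gauge_degree _ J) => //.
- by move=> n z z1; apply/gauge_bop/(normr_root_unity z1).
- by move=> n z y z1; apply/gauge_norm/(normr_root_unity z1).
- exact: gauge_homog.
- elim/int_ind => [|d IH|d IH] y Jy My.
  + exact: J0.
  + have ty j : t * upow (- j) * y = 0.
      apply: IH; first exact: lJ.
      apply: (cspan_map (bop_mull _) (cspan_closed _)) My => _ [a [m [n [b [mn ->]]]]].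
      rewrite -mulrA upow_mono //; case: m mn => [|m] mn; first by exfalso; lia.
      have [k [->|->]] := int_parity (- j + a); last first.
        by rewrite stars_mono_odd //; apply: clsub0 (cspan_closed _).
      rewrite stars_mono_even //; apply: cspan_sub; exists k, m, n, b; split=> //; lia.
    have [_ _ _ sum] := rel; rewrite -[y]mul1r -sum mulrDl -!mulrA.
    have := ty 0; rewrite mulr1 => ->; rewrite mulr0 add0r.
    by have := ty 1; rewrite upowN1 -mulrA => ->; rewrite !mulr0.
  + have sy : s * y = 0.
      apply: IH; first exact: lJ.
      apply: (cspan_map (bop_mull _) (cspan_closed _)) My => _ [a [m [n [b [mn ->]]]]].
      by rewrite s_mono //; apply: cspan_sub; exists (2 * a), m.+1, n, b; split=> //; lia.
    by have [_ iso _ _] := rel; rewrite -[y]mul1r -iso -mulrA sy mulr0.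
- by rewrite cspan_gauge_degree.
Qed.

(** A component of degree d is moved into the diagonal by the unitary u^{-d}, which lies in the
    core. *)
Lemma phase_vanishing (J : set Q) : closed_subspace J ->
  (forall x y, core x -> J y -> J (x * y)) ->
  (forall n (z : C) x, z ^+ (2 ^ n) = 1 -> J x -> J (phase_conj n z x)) ->
  (forall x, J x -> cspan (diag_degree 0) x -> x = 0) ->
  forall x, J x -> core x -> x = 0.
Proof.
move=> cJ lJ gJ J0 x Jx; rewrite /core gauge_degree0E.
apply: (@homogeneous_vanishing _ _ phase_conj _ _ diag_degree _ J) => //.
- by move=> n z _; apply: phase_conj_bop.
- exact: phase_conj_norm.
- by move=> n z d y; apply: phase_conj_diagonal.
- move=> d y Jy My; have : upow (- d) * y = 0.
    apply: J0; first by apply: lJ => //; apply: core_upow.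
    apply: (cspan_map (bop_mull _) (cspan_closed _)) My => _ [m [a [b [<- ->]]]].
    by rewrite upow_mono //; apply: cspan_sub; exists m, (- (a - b) + a), b; split=> //; ring.
  by move/(congr1 ( *%R (upow d))); rewrite mulrA upowKN // mul1r mulr0.
Qed.

End Gradings.

(** * The trace *)

Section Trace.
Context {R : realType} {Q : cstarAlgType R}.
Local Notation C := R[i]%C.
Local Notation N := (@cnorm R Q).
Variables u s : Q.
Hypothesis hQ : is_Q2 u s.
Local Notation t := (star s).
Local Notation p2 m := ((2 ^ m)%N%:Z).
Let rel : Q2_relations u s := Q2_rel hQ.
Let hu : unitary u := Q2_unitary rel.
Local Notation upow := (upow u).
Local Notation mono := (mono u s).
Local Notation qproj := (qproj u s).
Local Notation diag := (diag u s).
Local Notation core := (core u s).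
Local Notation diag_degree := (diag_degree u s).
Local Notation diag_part := (component (phase_conj u s) 0).

(* The trace of [x] is the limit of these averages. *)
Definition trace_mean (n : nat) (x : Q) : Q :=
  ((2 ^ n)%:R^-1 : C) *:
  \sum_(j < 2 ^ n) upow j * diag_part n x * upow (- j%:Z).

Lemma diag_part_bop n : bounded_op (diag_part n).
Proof.
apply: component_bop => [m z _|m z x]; first exact: phase_conj_bop.
exact: phase_conj_norm.
Qed.

Lemma diag_part_degree k n x : diag_degree k x -> (`|k| < 2 ^ n)%N ->
  diag_part n x = if k == 0 then x else 0.
Proof.
move=> kx kn; apply: (@component_homog_large _ _ _ diag_degree) => //.
  by move=> m z d y; apply: phase_conj_diagonal.
by rewrite subr0.
Qed.

Lemma trace_mean_norm n x : N (trace_mean n x) <= N x.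
Proof.
rewrite /trace_mean cnormZVn mulrC ler_pdivrMr ?ltr0n ?expn_gt0 //.
rewrite (le_trans (cnorm_sum _ _ _)) // mulrC.
have -> : (2 ^ n)%:R * N x = \sum_(i < 2 ^ n) N x.
  by rewrite sumr_const card_ord mulr_natl.
apply: ler_sum => i _.
rewrite (le_trans (cnorm_mulr_le _ _)) ?upow_norm // (le_trans (cnorm_mull_le _ _)) ?upow_norm //.
by apply: component_norm => m z y; apply: phase_conj_norm.
Qed.

Lemma trace_mean_bop n : bounded_op (trace_mean n).
Proof.
apply: bop_contraction => [x y|a x|x]; last exact: trace_mean_norm.
- rewrite /trace_mean -scalerDr -big_split; congr (_ *: _); apply: eq_bigr => i _ /=.
  by rewrite (bopD (diag_part_bop n)) mulrDr mulrDl.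
- rewrite /trace_mean scalerA mulrC -scalerA; congr (_ *: _).
  rewrite scaler_sumr; apply: eq_bigr => i _ /=.
  by rewrite (bopZ (diag_part_bop n)) -scalerAr -scalerAl.
Qed.

(** On the core this plays the part of the kernel of the trace; no scalar-valued functional is
    constructed. *)
Definition traceless : set Q := [set x | tends (trace_mean^~ x) 0].

Lemma traceless_closed : closed_subspace traceless.
Proof. exact: clsub_tends0 trace_mean_bop trace_mean_norm. Qed.

Lemma traceless_diagonal k x : k != 0 -> diag_degree k x -> traceless x.
Proof.
move=> k0 kx; apply: (@tends_eventually _ _ _ _ `|k|%N) => n kn.
rewrite /trace_mean (diag_part_degree kx); last by rewrite (leq_ltn_trans kn) // ltn_exp2.
by rewrite (negPf k0) big1 ?scaler0 // => j _; rewrite mulr0 mul0r.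
Qed.

Lemma mono_upow a m n b j : mono a m n b * upow (- j) = mono a m n (j + b).
Proof. by rewrite /mono -!mulrA -upowD // -opprD addrC. Qed.

(** The power of u carried past s^m on the left and past the adjoint on the right becomes u^k u^{-k}
    in the middle. *)
Lemma mono_shift k a m n b :
  mono (a + p2 m * k) m n (b + p2 n * k) = mono a m n b.
Proof.
rewrite /mono upowD // opprD [- b + _]addrC upowD // -(mulrA (upow a)) -(sX_upow rel).
rewrite -mulrN mulrA -(mulrA _ (t ^+ n)) -(upow_starsX rel) !mulrA.
by rewrite -(mulrA _ (upow k)) upowKN // mulr1.
Qed.

(** A sum over a full period 2^n does not change when a is shifted by 1, so the 2^m projections of
    level m have equal means, and they add up to 1. *)
Lemma trace_mean_qproj m n a : (m <= n)%N ->
  trace_mean n (qproj m a) = (2 ^ m)%:R^-1 *: 1.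
Proof.
move=> mn; pose f (b : int) : Q := \sum_(j < 2 ^ n) qproj m (j%:Z + b).
have fE b : trace_mean n (qproj m b) = ((2 ^ n)%:R^-1 : C) *: f b.
  have q0 : diag_degree 0 (qproj m b) by exists m, b, b; rewrite subrr.
  rewrite /trace_mean (diag_part_degree q0) ?expn_gt0 // eqxx; congr (_ *: _).
  by apply: eq_bigr => j _; rewrite upow_mono // mono_upow.
have f_succ b : f (1 + b) = f b.
  rewrite /f -(big_mkord xpredT (fun j : nat => qproj m (j%:Z + (1 + b)))).
  rewrite -(big_mkord xpredT (fun j : nat => qproj m (j%:Z + b))).
  have n0 : (0 < 2 ^ n)%N by rewrite expn_gt0.
  rewrite -(prednK n0) big_nat_recr // [RHS]big_nat_recl //= addrC; congr (_ + _).
    (* The last term wraps around to the first one: the indices differ by 2^n, a multiple of 2^m. *)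
    have -> : (2 ^ n).-1%:Z + (1 + b) = b + p2 m * p2 (n - m).
      by rewrite -PoszM -expnD subnKC // -{2}(prednK n0) intS; ring.
    by rewrite add0r; apply: mono_shift.
  by apply: eq_bigr => j _; rewrite intS addrCA addrA.
have f0 b : f b = f 0.
  elim/int_ind: b => [//|b IH|b IH]; first by rewrite intS f_succ.
  by rewrite -IH -(f_succ (- b.+1%:Z)) intS opprD addrA subrr add0r.
have tr0 b : trace_mean n (qproj m b) = trace_mean n (qproj m 0).
  by rewrite !fE f0.
have : trace_mean n 1 = 1.
  have d1 : diag_degree 0 1 by exists 0, 0, 0; rewrite mono0000 subrr.
  rewrite /trace_mean (diag_part_degree d1) ?expn_gt0 // eqxx.
  under eq_bigr do rewrite mulr1 upowKN //.
  by rewrite sumr_const card_ord -[(1 : Q) *+ _]scaler_nat scalerA mulVf ?scale1r ?pow2_neq0.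
rewrite -{1}(sum_qproj rel m) (bop_sum _ _ _ (trace_mean_bop n)) tr0.
under eq_bigr do rewrite tr0.
rewrite sumr_const card_ord => <-.
by rewrite -[trace_mean _ _ *+ _]scaler_nat scalerA mulVf ?scale1r ?pow2_neq0.
Qed.

Lemma bop_commutator_l y : bounded_op (fun x : Q => x * y - y * x).
Proof. exact: bop_sub (bop_mulr y) (bop_mull y). Qed.

Lemma bop_commutator_r x : bounded_op (fun y : Q => x * y - y * x).
Proof. exact: bop_sub (bop_mull x) (bop_mulr x). Qed.

(** In total degree 0 the two products vanish under the same divisibility condition, and otherwise
    both are projections of level m, with equal means. In any other degree each product is
    traceless. *)
Lemma commutator_mono_traceless m a b c d :
  traceless (mono a m m b * mono c m m d - mono c m m d * mono a m m b).
Proof.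
have cT := traceless_closed; rewrite !mono_mul //.
have [k0|k0] := eqVneq (a - b + (c - d)) 0.
  have -> : a + (c - b) = d by lia.
  have -> : c + (a - d) = b by lia.
  have -> : c - b = - (a - d) by lia.
  rewrite rpredN; case: ifP => _; last by rewrite subrr; apply: (clsub0 cT).
  apply: (@tends_eventually _ _ _ _ m) => n mn.
  by rewrite (bopB _ _ (trace_mean_bop n)) !trace_mean_qproj // subrr.
apply: (clsubB cT); case: ifP => _; try exact: (clsub0 cT);
  apply: (traceless_diagonal k0).
- by exists m, (a + (c - b)), d; split=> //; ring.
- by exists m, (c + (a - d)), b; split=> //; ring.
Qed.

Lemma commutator_traceless x y : core x -> core y -> traceless (x * y - y * x).
Proof.
have cT := traceless_closed.
pose lvl m := [set x | exists a b, x = mono a m m b].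
have lvl_raise m n a b : (m <= n)%N -> cspan (lvl n) (mono a m m b).
  move=> mn; rewrite (mono_raise rel (n - m)) subnKC //.
  apply: clsub_sum (cspan_closed _) _ => r _ _; apply: cspan_sub; by do 2! eexists.
apply: (cspan_map2 bop_commutator_r bop_commutator_l cT) => {}x {}y.
rewrite (gauge_degree0E u s) => -[_ [m [a [b [_ ->]]]]] [_ [n [c [d [_ ->]]]]].
apply: (cspan_map2 (S := lvl (maxn m n)) (S' := lvl (maxn m n))
  bop_commutator_r bop_commutator_l cT).
- by move=> _ _ [a' [b' ->]] [c' [d' ->]]; apply: commutator_mono_traceless.
- by apply: lvl_raise; apply: leq_maxl.
- by apply: lvl_raise; apply: leq_maxr.
Qed.

(* [V i0 V i0^*] cuts [a] into one of [#|I|] blocks of equal trace, whose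
   block-diag_degree sum has norm at most [cnorm a]. *)
Lemma trace_mean_block (I : finType) (V : I -> Q) (i0 : I) (a : Q) :
  (forall i j, star (V i) * V j = if i == j then 1 else 0) ->
  \sum_i V i * star (V i) = 1 -> (forall i j, core (V i * star (V j))) ->
  core a -> forall e : R, 0 < e -> exists n0, forall n, (n0 <= n)%N ->
  #|I|%:R * N (trace_mean n (V i0 * star (V i0) * a)) <= N a + e.
Proof.
move=> Vorth Vsum Vcore Ba e e0.
(* The V i are isometries with orthogonal ranges adding up to 1, so f is a unital homomorphism
   preserving adjoints, hence contractive. *)
pose f (b : Q) := \sum_i V i * b * star (V i).
have hf : star_hom_on setT f.
  split=> [|x y _ _|c x _|x y _ _|x _].
  - by rewrite -[RHS]Vsum; apply: eq_bigr => i _; rewrite mulr1.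
  - by rewrite /f -big_split; apply: eq_bigr => i _; rewrite mulrDr mulrDl.
  - by rewrite /f scaler_sumr; apply: eq_bigr => i _; rewrite -scalerAr -scalerAl.
  - rewrite /f mulr_suml; apply: eq_bigr => i _; rewrite mulr_sumr (bigD1 i) //= big1.
      by rewrite addr0 !mulrA -(mulrA (V i * x) (star _)) Vorth eqxx mulr1.
    move=> j ji; rewrite !mulrA -(mulrA (V i * x) (star _)) Vorth eq_sym (negPf ji).
    by rewrite mulr0 !mul0r.
  - by rewrite /f star_sum; apply: eq_bigr => i _; rewrite !starM starK mulrA.
have V1 : N (V i0) = 1 by apply: cnorm_isometry; rewrite /Defs.isometry Vorth eqxx.
pose X := f (star (V i0) * a * V i0).
have NX : N X <= N a.
  rewrite (le_trans (star_hom_contraction (@setT_subalgebra _ Q) _ hf _)) //.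
  rewrite (le_trans (cnorm_mulr_le _ _)) ?V1 //.
  by rewrite (le_trans (cnorm_mull_le _ _)) // cnorm_star V1.
pose y := V i0 * star (V i0) * a.
have : traceless (X - (#|I|%:R : C) *: y).
  have -> : X - (#|I|%:R : C) *: y = \sum_i (V i * (star (V i0) * a * V i0) * star (V i) - y).
    by rewrite sumrB sumr_const scaler_nat.
  apply: clsub_sum traceless_closed _ => i _ _.
  (* The translated block is p q and y is q p: they differ by a commutator in the core. *)
  pose p := V i * star (V i0) * a; pose q := V i0 * star (V i).
  have -> : V i * (star (V i0) * a * V i0) * star (V i) = p * q.
    by rewrite /p /q !mulrA.
  have -> : y = q * p.
    by rewrite /p /q !mulrA -(mulrA (V i0) (star _)) Vorth eqxx mulr1.
  apply: (commutator_traceless (x := p) (y := q)); last exact: Vcore.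
  exact: (coreM hQ (Vcore _ _) Ba).
case/(_ _ e0) => n0 h; exists n0 => n /h.
rewrite subr0 (bopB _ _ (trace_mean_bop n)) (bopZ (trace_mean_bop n)) cnorm_distC => le.
rewrite -cnormZn; have := cnormD ((#|I|%:R : C) *: trace_mean n y - trace_mean n X) (trace_mean n X).
rewrite subrK; have := trace_mean_norm n X; lra.
Qed.

Lemma sX_orth m (i j : 'I_(2 ^ m)) :
  star (upow i * s ^+ m) * (upow j * s ^+ m) = if i == j then 1 else 0.
Proof.
rewrite starM starX star_upow !mulrA -(mulrA (t ^+ m)) -upowD // addrC.
rewrite eq_sym -dvdz_sub_ord; case: ifP => [/dvdzP[k e]|/negbT nd].
  have kE : (p2 m %| j%:Z - i%:Z)%Z by rewrite e dvdz_mull.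
  move: kE; rewrite dvdz_sub_ord => /eqP ->.
  by rewrite subrr -(mulr0 (p2 m)) compress_dvd.
by rewrite compress_ndvd.
Qed.

(** Let y = sum of c_j q_j be near x. Each q_j x is traceless, and q_j (y - x) is one of 2^m blocks,
    so its trace is at most about 2^{-m} |y - x|. As q_j has trace 2^{-m}, every c_j is small, and
    so is y. *)
Lemma trace_faithful_diagonal (J : set Q) : (forall x y, core x -> J y -> traceless (x * y)) ->
  forall x, J x -> cspan (diag_degree 0) x -> x = 0.
Proof.
move=> JT x Jx Dx; apply: cnorm_small => e e0; have e4 : 0 < e / 4 by lra.
have core0 z : cspan (diag_degree 0) z -> core z.
  by apply: cspan_mono => ? ?; rewrite gauge_degree0E; exists 0.
have [m [y [xy yq]]] := diag_degree0_approx hQ Dx e4.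
have /choice[c cE] : forall j : nat, exists c : C, y * qproj m j = c *: qproj m j.
  by move=> j; apply: yq.
have yE : y = diag m c.
  rewrite -[LHS]mulr1 -(sum_qproj rel m) mulr_sumr; apply: eq_bigr => j _; exact: cE.
have core_y : core y.
  rewrite yE; apply: clsub_sum (cspan_closed _) _ => j _ _; apply: (clsubZ (cspan_closed _)).
  exact: core_mono.
have pow0 : 0 < (2 ^ m)%:R :> R by rewrite ltr0n expn_gt0.
have cj (j : 'I_(2 ^ m)) : complex.Re `|c j| <= 3 * (e / 4).
  have core_q : core (qproj m j) by apply: core_mono.
  (* After multiplication by 2^m the term q_j x contributes e/4, and the block bound contributes e/4
     for |y - x| and e/4 of slack. *)
  have d0 : 0 < e / 4 / (2 ^ m)%:R by rewrite divr_gt0.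
  have [n1 h1] := JT _ _ core_q Jx _ d0.
  pose V (i : 'I_(2 ^ m)) := upow i * s ^+ m.
  have Vsum : \sum_i V i * star (V i) = 1.
    rewrite -[RHS](sum_qproj rel m); apply: eq_bigr => i _.
    by rewrite starM starX star_upow !mulrA.
  have Vcore i k : core (V i * star (V k)).
    by have := @core_mono _ _ u s i m k; rewrite /mono starM starX star_upow !mulrA.
  have core_d : core (y - x) by apply: (clsubB (cspan_closed _)) => //; apply: core0.
  have [n2 h2] := trace_mean_block j (@sX_orth m) Vsum Vcore core_d e4.
  pose n := maxn m (maxn n1 n2).
  have := h1 n; have := h2 n.
  rewrite !leq_max !leqnn !orbT subr0 card_ord starM starX star_upow => /(_ isT) a2 /(_ isT) a1.
  move: a2; rewrite (_ : _ * _ * (y - x) = qproj m j * y - qproj m j * x); last first.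
    by rewrite mulrBr /qproj /mono !mulrA.
  have -> : qproj m j * y = c j *: qproj m j.
    rewrite yE /diag mulr_sumr (bigD1 j) //= big1 ?addr0.
      by rewrite -scalerAr qproj_orth // eqxx.
    by move=> k kj; rewrite -scalerAr qproj_orth // eq_sym (negPf kj) scaler0.
  rewrite (bopB _ _ (trace_mean_bop n)) (bopZ (trace_mean_bop n)).
  rewrite trace_mean_qproj ?leq_maxl //.
  have : N (c j *: ((2 ^ m)%:R^-1 *: 1) : Q) = complex.Re `|c j| / (2 ^ m)%:R.
    by rewrite cnormZ cnormZVn cnorm1 mulr1.
  move: (_ *: (_ *: 1)) => v vE.
  move: a1; rewrite ltr_pdivlMr // => a1 a2.
  have := cnormD (v - trace_mean n (qproj m j * x)) (trace_mean n (qproj m j * x)).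
  rewrite subrK vE ler_pdivrMr // mulrDl => a3.
  rewrite cnorm_distC in xy.
  move: a2 a1 a3; rewrite [(2 ^ m)%:R * _]mulrC; lra.
have : N y <= 3 * (e / 4).
  rewrite yE; apply: (diag_norm rel) => [|j jm]; first lra.
  exact: cj (Ordinal jm).
have := cnormD (x - y) y; rewrite subrK; lra.
Qed.

End Trace.

(** * Intertwiners *)

Section Vanishing.
Context {R : realType} {Q : cstarAlgType R}.
Local Notation C := R[i]%C.
Local Notation N := (@cnorm R Q).
Variables u s : Q.
Hypothesis hQ : is_Q2 u s.
Local Notation t := (star s).
Local Notation p2 m := ((2 ^ m)%N%:Z).
Let rel : Q2_relations u s := Q2_rel hQ.
Let hu : unitary u := Q2_unitary rel.
Local Notation upow := (upow u).
Local Notation mono := (mono u s).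
Local Notation qproj := (qproj u s).
Local Notation core := (core u s).
Local Notation diag_degree := (diag_degree u s).
Local Notation O2 := (O2 u s).

Lemma O2_subalgebra : cstar_subalgebra O2.
Proof. exact: cstar_gen_subalgebra. Qed.

Lemma O2_s b : O2 (s_ u s b).
Proof. by move=> S [_]; apply; case: b; [left|right]. Qed.

Lemma s_range_sum :
  s_ u s false * star (s_ u s false) + s_ u s true * star (s_ u s true) = 1.
Proof. by case: rel => _ _ _ <-; rewrite /= starM !mulrA. Qed.

Lemma O2_1 : O2 1.
Proof.
have sO := O2_subalgebra; rewrite -s_range_sum.
by apply: (csubD sO); apply: (csubM sO); try apply: (csub_star sO); apply: O2_s.
Qed.

Lemma O2_word mu : O2 (s_word u s mu).
Proof.
elim: mu => [|b mu IH]; first by rewrite /s_word big_nil; apply: O2_1.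
by rewrite /s_word big_cons; apply: (csubM O2_subalgebra) => //; apply: O2_s.
Qed.

Lemma F2_mono a m b : O2 (mono a m m b) -> F2 u s (mono a m m b).
Proof. by move=> Ox; split=> // z z1; rewrite gauge_mono // subrr expr0z scale1r. Qed.

(** Since s_1 = u s = u^{-1} s u, its powers are u^{-1} s^n u, which explains the index -1. *)
Lemma s1X_range n : s_ u s true ^+ n * star (s_ u s true) ^+ n = qproj n (-1).
Proof.
have s1E : s_ u s true = upow (-1) * s * upow 1.
  by rewrite -mulrA s_upow // mulrA -upowD //= expr1.
have sE k : s_ u s true ^+ k = upow (-1) * s ^+ k * upow 1.
  elim: k => [|k IH]; first by rewrite mulr1 upowNK.
  by rewrite !exprSr IH s1E !mulrA -(mulrA _ (upow 1)) upowKN // mulr1.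
rewrite -starX sE !starM !star_upow !opprK starX /qproj /mono.
by rewrite !mulrA -(mulrA _ (upow 1)) upowKN // mulr1.
Qed.

(** * Images of the Cuntz isometries under an endomorphism of O_2 *)

Variable lam : Q -> Q.
Hypothesis hlam : star_endo O2 lam.
Let hhom : star_hom_on O2 lam. Proof. by case: hlam. Qed.
Local Notation S b := (lam (s_ u s b)).

Lemma lam0 : lam 0 = 0.
Proof. by rewrite -(scale0r (1 : Q)) (star_homZ hhom) ?scale0r //; apply: O2_1. Qed.

Lemma lam_sum (I : Type) (r : seq I) (F : I -> Q) : (forall i, O2 (F i)) ->
  lam (\sum_(i <- r) F i) = \sum_(i <- r) lam (F i).
Proof.
move=> OF; have sO := O2_subalgebra.
suff [] : O2 (\sum_(i <- r) F i) /\ lam (\sum_(i <- r) F i) = \sum_(i <- r) lam (F i) by [].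
elim: r => [|i r [Or IH]]; first by rewrite !big_nil lam0; split=> //; apply: csub0.
by rewrite !big_cons (star_homD hhom) // IH; split=> //; apply: (csubD sO).
Qed.

Lemma lam_mul_star x y : O2 x -> O2 y -> lam (x * star y) = lam x * star (lam y).
Proof.
move=> Ox Oy; rewrite (star_homM hhom) ?(star_hom_star hhom) //.
exact: (csub_star O2_subalgebra).
Qed.

Lemma lam_star_mul x y : O2 x -> O2 y -> lam (star x * y) = star (lam x) * lam y.
Proof.
move=> Ox Oy; rewrite (star_homM hhom) ?(star_hom_star hhom) //.
exact: (csub_star O2_subalgebra).
Qed.

Lemma lam_norm x : O2 x -> N (lam x) <= N x.
Proof. exact: star_hom_contraction O2_subalgebra O2_1 hhom _. Qed.

Lemma S_isometry b : star (S b) * S b = 1.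
Proof.
rewrite -lam_star_mul; try exact: O2_s.
rewrite (_ : star _ * _ = 1) ?(star_hom1 hhom) //.
have ss : t * s = 1 by case: rel.
case: b => //=; rewrite starM -mulrA (mulrA _ u).
by case: hu => -> _; rewrite mul1r.
Qed.

Lemma S_orth : star (S true) * S false = 0.
Proof.
rewrite -lam_star_mul; try exact: O2_s.
by rewrite -[X in lam X]starK starM starK /= (mulrA t) (stars_u_s rel) star0 lam0.
Qed.

Lemma S_range_sum : S false * star (S false) + S true * star (S true) = 1.
Proof.
have sO := O2_subalgebra.
have OO b : O2 (s_ u s b * star (s_ u s b)).
  by apply: (csubM sO); [|apply: (csub_star sO)]; apply: O2_s.
rewrite -!lam_mul_star; try exact: O2_s.
by rewrite -(star_homD hhom) // s_range_sum (star_hom1 hhom).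
Qed.

Definition range_proj (n : nat) : Q := S true ^+ n * star (S true) ^+ n.

Lemma O2X x n : O2 x -> O2 (x ^+ n).
Proof.
move=> Ox; elim: n => [|n IH]; first exact: O2_1.
by rewrite exprS; apply: (csubM O2_subalgebra).
Qed.

Lemma O2_qproj n : O2 (qproj n (-1)).
Proof.
rewrite -s1X_range; apply: (csubM O2_subalgebra); apply: O2X; last apply: (csub_star O2_subalgebra);
exact: O2_s.
Qed.

Lemma lamX x n : O2 x -> lam (x ^+ n) = lam x ^+ n.
Proof.
move=> Ox; elim: n => [|n IH]; first by rewrite !expr0 (star_hom1 hhom).
by rewrite !exprS (star_homM hhom) ?IH //; apply: O2X.
Qed.

Lemma range_projE n : range_proj n = lam (qproj n (-1)).
Proof.
have Os := O2_s true; rewrite -s1X_range -starX lam_mul_star; try exact: O2X.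
by rewrite lamX // starX.
Qed.

(** For a in J and in the core, a = a P_K has the trace of P_K a, one of 2^K blocks. The condition
    on F_2 puts the partial isometries joining the blocks in the core. *)
Lemma range_proj_vanishing_core (J : set Q) : closed_subspace J ->
  (forall x y, J y -> J (x * y)) -> (forall n x, J x -> x * range_proj n = x) ->
  lam @` F2 u s `<=` F2 u s -> forall x, J x -> core x -> x = 0.
Proof.
move=> cJ lJ JP F2F.
have coreF x : F2 u s x -> core (lam x).
  by move=> Fx; apply: (core_F2 hQ); apply: F2F; exists x.
have cB : closed_subspace core := cspan_closed _.
have tl x y : J y -> core x -> core y -> traceless u s (x * y).
  move=> Jy Bx By; pose a := x * y.
  have Ja : J a by apply: lJ.
  have Ba : core a by apply: coreM.
  (* K is taken so large that the block bound 2^{-K} (|a| + 1) is below e/2. *)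
  move=> e e0; pose K := (Num.truncn ((N a + 1) / (e / 2))).+1.
  have Ka : (N a + 1) / (e / 2) < (2 ^ K)%:R.
    have : (N a + 1) / (e / 2) < K%:R by rewrite truncnS_gt.
    by move=> /lt_le_trans; apply; rewrite ler_nat ltnW // ltn_exp2.
  have /choice[mu /choice[k muE]] : forall j : nat, exists (mu : seq bool) (k : int),
      upow j * s ^+ K = s_word u s mu * upow k.
    by move=> j; apply: upow_sX_word.
  have wE j : s_word u s (mu j) = upow j * s ^+ K * upow (- k j).
    by rewrite muE -mulrA upowKN // mulr1.
  pose V (j : 'I_(2 ^ K)) := lam (s_word u s (mu j)).
  have Vorth i j : star (V i) * V j = if i == j then 1 else 0.
    rewrite -lam_star_mul; try exact: O2_word.
    have -> : star (s_word u s (mu i)) * s_word u s (mu j) =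
        upow (k i) * (star (upow i * s ^+ K) * (upow j * s ^+ K)) * upow (- k j).
      by rewrite !wE !starM !star_upow opprK !mulrA.
    rewrite sX_orth //.
    case: eqP => [->|_]; last by rewrite mulr0 mul0r lam0.
    by rewrite mulr1 upowKN // (star_hom1 hhom).
  have WW i j : exists c d, s_word u s (mu i) * star (s_word u s (mu j)) = mono c K K d.
    exists (i%:Z + p2 K * (- k i + k j)), j%:Z.
    rewrite !wE !starM !star_upow starX opprK /mono upowD // -(mulrA (upow i) _ (s ^+ K)).
    by rewrite -sX_upow // upowD // !mulrA.
  have OW i j : O2 (s_word u s (mu i) * star (s_word u s (mu j))).
    by apply: (csubM O2_subalgebra); [|apply: (csub_star O2_subalgebra)]; apply: O2_word.
  have Vcore i j : core (V i * star (V j)).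
    rewrite -lam_mul_star; try exact: O2_word; apply: coreF.
    have [c [d cd]] := WW i j; rewrite cd; apply: F2_mono; rewrite -cd; exact: OW.
  have Wq i : s_word u s (mu i) * star (s_word u s (mu i)) = qproj K i.
    rewrite wE !starM !star_upow starX opprK /qproj /mono !mulrA.
    by rewrite -(mulrA _ (upow _) (upow (k i))) upowNK // mulr1.
  have Vsum : \sum_i V i * star (V i) = 1.
    rewrite (_ : 1 = lam (\sum_(i < 2 ^ K) s_word u s (mu i) * star (s_word u s (mu i)))).
      rewrite lam_sum //; apply: eq_bigr => i _.
      by rewrite lam_mul_star //; apply: O2_word.
    rewrite -(star_hom1 hhom) -(sum_qproj rel K); congr lam; apply: eq_bigr => i _.
    by rewrite Wq.
  have i0K : ((2 ^ K).-1 < 2 ^ K)%N by rewrite prednK // expn_gt0.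
  (* The index -1 of the range of s_1^K, reduced modulo 2^K. *)
  pose i0 := Ordinal i0K.
  have Vi0 : V i0 * star (V i0) = range_proj K.
    rewrite range_projE -lam_mul_star; try exact: O2_word; rewrite Wq; congr lam.
    rewrite -[RHS](mono_shift hQ 1) /qproj mulr1.
    suff -> : i0%:Z = -1 + p2 K by [].
    have : (0 < 2 ^ K)%N by rewrite expn_gt0.
    by rewrite /=; lia.
  have [n1 h1] := trace_mean_block hQ i0 Vorth Vsum Vcore Ba (ltr01 : (0 : R) < 1).
  have coreP : core (range_proj K) by rewrite -Vi0.
  have e2 : 0 < e / 2 by lra.
  have [n2 h2] := commutator_traceless hQ coreP Ba e2.
  exists (maxn n1 n2) => n; rewrite geq_max subr0 => /andP[/h1 b1 /h2].
  move: b1; rewrite card_ord Vi0 (bopB _ _ (trace_mean_bop hQ n)) (JP K a Ja) subr0 => b1.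
  have : N (trace_mean u s n (range_proj K * a)) < e / 2.
    move: Ka; rewrite ltr_pdivrMr // => Ka.
    have p0 : 0 < (2 ^ K)%:R :> R by rewrite ltr0n expn_gt0.
    by rewrite -(ltr_pM2l p0); apply: le_lt_trans b1 Ka.
  have := cnormD (trace_mean u s n a - trace_mean u s n (range_proj K * a))
                 (trace_mean u s n (range_proj K * a)).
  rewrite subrK [N (trace_mean _ _ _ a - _)]cnorm_distC -/a; lra.
move=> y Jy By.
(* J is replaced by a larger left ideal of the core, whose stability under phase conjugation comes
   from the trace property. *)
pose J1 := core `&` [set z | forall x, core x -> traceless u s (x * z)].
have cJ1 : closed_subspace J1.
  apply: clsub_setI => //; apply: clsub_bigcap => x; apply: clsub_imply.
  exact: clsub_preim (bop_mull x) (traceless_closed _).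
have J1y : J1 y by split=> // x Bx; apply: tl.
apply: (phase_vanishing hQ cJ1) J1y By => [x z Bx [Bz Tz]|n z x z1 [Bx Tx]|].
- split; first exact: coreM.
  by move=> x' Bx'; rewrite mulrA; apply: Tz; apply: coreM.
- have Bw : core (phase u s n z) := core_phase n z.
  have Bws : core (star (phase u s n z)).
    exact: (csub_star (core_subalgebra hQ)).
  split; first by apply: coreM => //; apply: coreM.
  move=> x' Bx'; pose w := phase u s n z.
  (* Moving w^* to the front costs a commutator and leaves a core element times x. *)
  have -> : x' * phase_conj u s n z x =
      (x' * (w * x) * star w - star w * (x' * (w * x))) + star w * x' * w * x.
    by rewrite /phase_conj !mulrA subrK.
  apply: (clsubD (traceless_closed _)) => //.
    by apply: commutator_traceless => //; do 2! apply: coreM => //.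
  by apply: Tx; do 2! apply: coreM => //.
- by apply: (trace_faithful_diagonal hQ) => x z Bx [_]; apply.
Qed.

(** The P_n lie in the diagonal, which phase conjugation fixes pointwise, so J is stable under it.
    For an element of J in the diagonal, P_m and P_{m+1} are compared. *)
Lemma range_proj_vanishing_diag (J : set Q) : closed_subspace J ->
  (forall x y, J y -> J (x * y)) -> (J = [set x | forall n, x * range_proj n = x]) ->
  lam @` D2 u s = D2 u s -> forall x, J x -> core x -> x = 0.
Proof.
move=> cJ lJ JE; rewrite D2_eq // => DD.
have qD n : cspan (diag_degree 0) (qproj n (-1)).
  by apply: cspan_sub; exists n, (-1), (-1); rewrite subrr.
have DO x : cspan (diag_degree 0) x -> O2 x.
  rewrite -D2_eq // => Dx; apply: Dx; split; first exact: O2_subalgebra.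
  move=> _ [mu _ <-]; apply: (csubM O2_subalgebra); last apply: (csub_star O2_subalgebra);
  exact: O2_word.
have PD n : cspan (diag_degree 0) (range_proj n).
  by rewrite range_projE -DD; exists (qproj n (-1)).
apply: (phase_vanishing hQ cJ) => [x y _|n z x z1 Jx|d Jd Dd]; first exact: lJ.
- move: Jx; rewrite JE /= => Jx m.
  have [w1 w2] : unitary (phase u s n z) by apply/phase_unitary/(normr_root_unity z1).
  have wP : phase_conj u s n z (range_proj m) = range_proj m.
    move: (range_proj m) (PD m); apply: cspan_min.
      exact: (clsub_eq (phase_conj_bop u s n z) bop_id).
    by move=> y Dy /=; rewrite (phase_conj_diagonal hQ z1 Dy) expr0z scale1r.
  have Pw : star (phase u s n z) * range_proj m = range_proj m * star (phase u s n z).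
    by rewrite -{1}wP /phase_conj !mulrA w1 mul1r.
  move: (range_proj m) (Jx m) Pw => P JP Pw.
  by rewrite /phase_conj -mulrA Pw !mulrA -(mulrA _ x) JP.
apply: cnorm_small => e e0; have e2 : 0 < e / 2 by lra.
have [d' Dd' dE] : (lam @` cspan (diag_degree 0)) d by rewrite DD.
have [m [y [dy yq]]] := diag_degree0_approx hQ Dd' e2.
have [c yc] := yq m (-1) (leqnn _).
move: Jd; rewrite JE /= => Jd.
(* An isometry with range P_m - P_{m+1}: d kills it because d = d P_{m+1}, while c P_m acts on it as
   c. Hence |c| is at most the distance from d to c P_m. *)
pose v := S true ^+ m * S false.
have XX : star (S true) ^+ m * S true ^+ m = 1 by apply: starX_mulX; rewrite S_isometry.
have Ov : star v * v = 1.
  rewrite /v starM -mulrA (mulrA (star (S true ^+ m))) starX.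
  by rewrite XX mul1r S_isometry.
have NV : N v = 1 by apply: cnorm_isometry.
have dv : d * v = 0.
  rewrite -(Jd m.+1) /range_proj /v [star (S true) ^+ m.+1]exprS -!mulrA.
  by rewrite (mulrA (star (S true) ^+ m)) XX mul1r S_orth !mulr0.
have Pv : range_proj m * v = v.
  by rewrite /range_proj /v -!mulrA (mulrA (star (S true) ^+ m)) XX mul1r.
(* d = d P_m is the image of d' q_m, which is close to y q_m = c q_m. *)
have dc : N (d - c *: range_proj m) < e / 2.
  rewrite -(Jd m) range_projE -dE -(star_homM hhom) //; try exact: DO.
  have Oq := DO _ (qD m); have sO := O2_subalgebra.
  have -> : lam (d' * qproj m (-1)) - c *: lam (qproj m (-1)) =
            lam ((d' - y) * qproj m (-1)).
    rewrite mulrBl yc -scaleN1r -(star_homZ hhom) // -(star_homZ hhom); last first.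
      exact: (csubZ sO).
    rewrite -(star_homD hhom) ?scaleN1r //; first by apply: (csubM sO) => //; apply: DO.
    by rewrite -scaleNr; apply: (csubZ sO).
  have Oy : O2 ((d' - y) * qproj m (-1)).
    rewrite mulrBl yc; apply: (clsubB (cstar_subalgebra_closed sO)); last exact: (csubZ sO).
    by apply: (csubM sO) => //; apply: DO.
  rewrite (le_lt_trans (lam_norm Oy)) // (le_lt_trans _ dy) // cnorm_mulr_le //.
  rewrite -s1X_range -starX (le_trans (cnormM _ _)) // cnorm_star.
  suff -> : N (s_ u s true ^+ m) = 1 by rewrite mul1r.
  apply: cnorm_isometry; rewrite /Defs.isometry starX; apply: starX_mulX.
  rewrite /= starM -mulrA (mulrA _ u); case: hu => -> _; rewrite mul1r.
  by case: rel.
have cn : N (c *: range_proj m) < e / 2.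
  have NP : N (range_proj m) <= 1.
    rewrite /range_proj -starX (le_trans (cnormM _ _)) // cnorm_star.
    suff -> : N (S true ^+ m) = 1 by rewrite mul1r.
    by apply: cnorm_isometry; rewrite /Defs.isometry starX.
  have : N ((d - c *: range_proj m) * v) <= N (d - c *: range_proj m) by rewrite cnorm_mulr_le ?NV.
  rewrite mulrBl dv -scalerAl Pv sub0r cnormN cnormZ NV mulr1 => cle.
  rewrite cnormZ (le_lt_trans _ dc) // (le_trans _ cle) //.
  by rewrite ler_piMr // Re_norm_ge0.
have := cnormD (d - c *: range_proj m) (c *: range_proj m); rewrite subrK; lra.
Qed.

Lemma intertwiner_vanishing y :
  lam @` F2 u s `<=` F2 u s \/ lam @` D2 u s = D2 u s ->
  y * S false = 0 -> y * S true = S false * y -> y = 0.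
Proof.
move=> hcond yf yt; pose J := [set x : Q | forall n, x * range_proj n = x].
have cJ : closed_subspace J.
  by apply: clsub_bigcap => n; apply: (clsub_eq (bop_mulr _) bop_id).
have lJ x z : J z -> J (x * z) by move=> Jz n; rewrite -mulrA Jz.
have Jy : J y.
  (* As y S_2 = 0, only the range of S_1 matters to y. *)
  have ytt : y * S true * star (S true) = y.
    by rewrite -[RHS]mulr1 -S_range_sum mulrDr !mulrA yf mul0r add0r.
  have ytn n : y * S true ^+ n = S false ^+ n * y.
    by elim: n => [|n IH]; rewrite ?mulr1 ?mul1r // exprSr mulrA IH -mulrA yt mulrA -exprSr.
  elim=> [|n IH]; first by rewrite /range_proj !mulr1.
  rewrite -[RHS]IH /range_proj exprSr exprS !mulrA ytn.
  by rewrite -!(mulrA (S false ^+ n)) ytt.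
have Pcore n : core (range_proj n).
  case: hcond => [F2F|DD].
    apply: (core_F2 hQ); apply: F2F; exists (qproj n (-1)); last by rewrite range_projE.
    by apply: F2_mono; apply: O2_qproj.
  have : D2 u s (range_proj n).
    rewrite range_projE -DD; exists (qproj n (-1)) => //; rewrite D2_eq //; apply: cspan_sub.
    by exists n, (-1), (-1); rewrite subrr.
  by rewrite D2_eq //; apply: cspan_mono => ? ?; rewrite gauge_degree0E; exists 0.
apply: (gauge_vanishing hQ cJ lJ) Jy => [n z x z1 Jx m|x Jx].
  (* P_m is fixed by the gauge action, so x P_m = x yields the same equation for the image of x. *)
  have hf := gauge_hom hQ (normr_root_unity z1).
  have /(coreP hQ) Pz := Pcore m.
  by rewrite -{1}(Pz n z z1) -(star_homM hf) // Jx.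
case: hcond => [F2F|DD]; last exact: (range_proj_vanishing_diag cJ lJ).
by apply: (range_proj_vanishing_core cJ lJ) => // n z; apply.
Qed.

End Vanishing.

(** * Uniqueness of the extension and the inclusion of commutants *)

Theorem theorem1p2 (R : realType) (Q : cstarAlgType R) (u s2 : Q)
    (hQ : is_Q2 u s2) (w : Q) (lam : Q -> Q)
    (hwO2 : O2 u s2 w) (hw : unitary w) (hlam : is_lambda u s2 w lam)
    (hcond : lam @` F2 u s2 `<=` F2 u s2 \/ lam @` D2 u s2 = D2 u s2) :
  (forall phi psi : Q -> Q,
     is_extension u s2 lam phi -> is_extension u s2 lam psi -> phi = psi) /\
  (forall phi : Q -> Q, unique (is_extension u s2 lam) phi ->
     commutant (lam @` O2 u s2) `<=` commutant (cstar_gen [set phi u])).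
Proof.
have [endo _] := hlam; have rel := Q2_rel hQ.
(* The images of u s_2 = s_1 and of u s_1 = u^2 s_2 = s_2 u. *)
have extS phi : is_extension u s2 lam phi ->
    phi u * lam (s_ u s2 false) = lam (s_ u s2 true) /\
    phi u * lam (s_ u s2 true) = lam (s_ u s2 false) * phi u.
  move=> [[hphi _] phiE]; rewrite -!phiE; try exact: O2_s.
  rewrite -!(star_homM hphi) //; split=> //.
  by congr phi; case: rel => _ _ /= ->; rewrite expr2 mulrA.
split=> [phi psi ephi epsi|phi [ephi _] x xS].
- have [f1 t1] := extS _ ephi; have [f2 t2] := extS _ epsi.
  have [[hphi _] phiE] := ephi; have [[hpsi _] psiE] := epsi.
  have uE : phi u = psi u.
    apply/subr0_eq/(intertwiner_vanishing hQ endo hcond).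
    + by rewrite mulrBl f1 f2 subrr.
    + by rewrite mulrBl mulrBr t1 t2.
  have Os : O2 u s2 s2 by apply: (@O2_s _ _ u s2 false).
  have sE : phi s2 = psi s2 by rewrite phiE // psiE.
  (* The relations hold for the images of the generators, so the universal property identifies phi
     with psi. *)
  have hom_rel : Q2_relations (phi u) (phi s2).
    have [[u1 u2] iso com sum] := rel.
    have pM y z : phi (y * z) = phi y * phi z by apply: (star_homM hphi).
    have pS y : phi (star y) = star (phi y) by apply: (star_hom_star hphi).
    have p1 := star_hom1 hphi.
    split.
    + by split; rewrite -pS -pM ?u1 ?u2.
    + by rewrite /Defs.isometry -pS -pM iso.
    + by rewrite expr2 -!pM com expr2.
    + by rewrite -!pS -!pM -(star_homD hphi) // sum.
  exact: (Q2_hom_ext hQ).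
- have [f t] := extS _ ephi.
  have xC b : x * lam (s_ u s2 b) = lam (s_ u s2 b) * x.
    by apply: xS; exists (s_ u s2 b) => //; apply: O2_s.
  have comm : x * phi u = phi u * x.
    apply/subr0_eq/(intertwiner_vanishing hQ endo hcond).
    + by rewrite mulrBl -!mulrA f !xC mulrA f subrr.
    + by rewrite mulrBl mulrBr -!mulrA t (xC true) !mulrA xC t.
  have uu : unitary (phi u).
    have [[hphi _] _] := ephi; have [u1 u2] := Q2_unitary rel.
    by split; rewrite -(star_hom_star hphi) // -(star_homM hphi) // ?u1 ?u2 (star_hom1 hphi).
  (* With v = phi u unitary, x v^* = v^* v x v^* = v^* x v v^* = v^* x. *)
  have comm_star : x * star (phi u) = star (phi u) * x.
    case: uu => uu1 uu2; rewrite -[LHS]mul1r -uu1 -mulrA (mulrA (phi u)) -comm.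
    by rewrite -(mulrA x) uu2 mulr1.
  (* Commutation with the adjoint is imposed too, which makes the set closed under [star]. *)
  pose T := [set y | x * y = y * x /\ x * star y = star y * x].
  have cT := clsub_eq (bop_mull x) (bop_mulr x).
  have sT : cstar_subalgebra T.
    split.
    + by split; rewrite ?star0 mulr0 mul0r.
    + by move=> y z [y1 y2] [z1 z2]; split; rewrite ?starD mulrDr mulrDl ?y1 ?y2 ?z1 ?z2.
    + by move=> a y [y1 y2]; split; rewrite ?starZ -scalerAr -scalerAl ?y1 ?y2.
    + move=> y z [y1 y2] [z1 z2]; split; rewrite ?starM mulrA.
        by rewrite y1 -mulrA z1 mulrA.
      by rewrite z2 -mulrA y2 mulrA.
    + by move=> y [y1 y2]; split; rewrite ?starK.
    + move=> y Hy; split; first by apply: (clsub_closed cT) => e /Hy[z [] ]; exists z.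
      apply: (clsub_closed cT) => e /Hy[z [_ z2] yz].
      by exists (star z); rewrite // -starB cnorm_star.
  by move=> y; case/(_ T) => //; split=> // _ ->.
Qed.
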